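(* There exist universal constants $c_1, C, C'>0$ such that the following holds. Let $\bm{M}^\star=\lambda^\star\bm{u}^\star\bm{u}^{\star\top}\in\mathbb{R}^{n\times n}$ be a rank-1 symmetric matrix ($\lambda^\star\neq 0$, $\|\bm{u}^\star\|_2=1$) with incoherence parameter $\mu$, and let $\bm{M}=\bm{M}^\star+\bm{H}$, where the random noise matrix $\bm{H}$ satisfies the noise assumption with parameters $\sigma,B$ (see context). Suppose $$\max\{\sigma\sqrt{n\log n},\,B\log n\}\le c_1|\lambda^\star|.$$ Let $\bm{u}$ be the leading eigenvector of $\bm{M}$. Then for any fixed vector $\bm{a}\in\mathbb{R}^n$ with $\|\bm{a}\|_2=1$, with probability at least $1-C'n^{-10}$, $$\min\big\{|\bm{a}^\top(\bm{u}-\bm{u}^\star)|,\,|\bm{a}^\top(\bm{u}+\bm{u}^\star)|\big\}\le C\left(|\bm{a}^\top\bm{u}^\star|+\sqrt{\frac{\mu}{n}}\right)\frac{\max\{\sigma\sqrt{n\log n},\,B\log n\}}{|\lambda^\star|}.$$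
   Context: Noise assumption with parameters $\sigma=\sigma_n\ge 0$, $B=B_n>0$ on a random matrix $\bm{H}=[H_{ij}]\in\mathbb{R}^{n\times n}$: (1) the entries $H_{ij}$, $1\le i,j\le n$, are independent (no symmetry is imposed, and they need not be identically distributed); (2) $\mathbb{E}[H_{ij}]=0$; (3) $\mathrm{Var}(H_{ij})\le\sigma^2$; (4) each $H_{ij}$ satisfies either (a) $|H_{ij}|\le B$, or (b) $H_{ij}$ has a symmetric distribution with $\mathbb{P}\{|H_{ij}|>B\}\le c_{\mathrm b}n^{-12}$, where $c_{\mathrm b}>0$ is a fixed universal constant. Incoherence parameter of $\bm{M}^\star=\lambda^\star\bm{u}^\star\bm{u}^{\star\top}$: the smallest $\mu$ with $\|\bm{u}^\star\|_\infty\le\sqrt{\mu/n}$. The leading eigenvector $\bm{u}$ of the (generally asymmetric) matrix $\bm{M}$ is a (right) eigenvector with $\|\bm{u}\|_2=1$ associated with the eigenvalue of $\bm{M}$ of largest modulus, taken real whenever that eigenvalue is real. *)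

(* Defs.v *)
From mathcomp Require Import all_boot all_order all_algebra.
From mathcomp Require Import all_classical all_reals all_analysis.
From mathcomp Require Import complex.

Set Implicit Arguments.
Unset Strict Implicit.
Unset Printing Implicit Defensive.

Import Order.TTheory GRing.Theory Num.Theory.

Local Open Scope classical_set_scope.
Local Open Scope ring_scope.

(** Vectors, possibly complex *)

Definition l2norm (R : realType) (n : nat) (u : 'cV[R]_n) : R :=
  Num.sqrt (\sum_(i < n) u i 0 ^+ 2).

Definition l2normC (R : realType) (n : nat) (u : 'cV[R[i]]_n) : R :=
  Num.sqrt (\sum_(i < n) ComplexField.Normc.normc (u i 0) ^+ 2).

Definition complexify (R : realType) (m n : nat) (A : 'M[R]_(m, n)) :
  'M[R[i]]_(m, n) := map_mx (real_complex R) A.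

(* [a] real, [v] complex; the transpose is not conjugated. *)
Definition lin_form (R : realType) (n : nat) (a : 'cV[R]_n)
  (v : 'cV[R[i]]_n) : R[i] := ((complexify a)^T *m v) 0 0.

(* [mx_norm] is the entrywise sup norm. *)
Definition incoherent (R : realType) (n : nat) (u : 'cV[R]_n) (mu : R) : Prop :=
  0 <= mu /\ mx_norm u <= Num.sqrt (mu / n%:R).

Definition incoherence_parameter (R : realType) (n : nat) (u : 'cV[R]_n)
  (mu : R) : Prop :=
  incoherent u mu /\ (forall mu' : R, incoherent u mu' -> mu <= mu').

(* The spectrum is taken over the complex numbers, as a real asymmetric matrix
   may have a non-real leading eigenvalue. [eigenvalue] is stated with row
   vectors, but [M] and [M^T] have the same eigenvalues; [u] itself is a right
   eigenvector. The predicate leaves free the phase of [u] (its sign, when the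
   eigenvalue is real) and the choice among eigenvalues of equal modulus. *)
Definition leading_eigenvector (R : realType) (n : nat) (M : 'M[R]_n)
  (u : 'cV[R[i]]_n) : Prop :=
  exists lam : R[i],
    [/\ eigenvalue (complexify M) lam,
        (forall nu : R[i], eigenvalue (complexify M) nu ->
           ComplexField.Normc.normc nu <= ComplexField.Normc.normc lam),
        complexify M *m u = lam *: u,
        l2normC u = 1 &
        (complex.Im lam = 0 -> forall i : 'I_n, complex.Im (u i 0) = 0)].

(** Probability *)

Definition mutually_independent (d : measure_display) (T : measurableType d)
  (R : realType) (P : probability T R) (I : finType) (X : I -> {RV P >-> R}) :
  Prop :=
  forall (J : {set I}) (A : I -> set R),
    (forall i, i \in J -> measurable (A i)) ->
    P [set w | forall i, i \in J -> A i (X i w)] =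
    (\prod_(i in J) P (X i @^-1` A i))%E.

Definition symmetric_distribution (d : measure_display) (T : measurableType d)
  (R : realType) (P : probability T R) (X : {RV P >-> R}) : Prop :=
  forall A : set R, measurable A ->
    P (X @^-1` A) = P ((fun w => - X w) @^-1` A).

(* For an event [S] that need not be measurable; when [S] is measurable this is
   [p <= P S]. *)
Definition with_probability_at_least (d : measure_display)
  (T : measurableType d) (R : realType) (P : probability T R) (p : R)
  (S : set T) : Prop :=
  exists E : set T, [/\ measurable E, E `<=` S & (p%:E <= P E)%E].

Definition noise_assumption (d : measure_display) (T : measurableType d)
  (R : realType) (P : probability T R) (cb : R) (n : nat) (sigma B : R)
  (H : 'I_n -> 'I_n -> {RV P >-> R}) : Prop :=
  [/\ mutually_independent (fun ij : 'I_n * 'I_n => H ij.1 ij.2),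
      (forall i j, 'E_P[H i j] = 0)%E,
      (forall i j, 'V_P[H i j] <= (sigma ^+ 2)%:E)%E &
      (forall i j,
         {ae P, forall w, `|H i j w| <= B} \/
         (symmetric_distribution (H i j) /\
          (P [set w | (B < `|H i j w|)%R] <= (cb * n%:R ^- 12)%:E)%E))].

Definition noise_matrix (d : measure_display) (T : measurableType d)
  (R : realType) (P : probability T R) (n : nat)
  (H : 'I_n -> 'I_n -> {RV P >-> R}) (w : T) : 'M[R]_n :=
  \matrix_(i < n, j < n) H i j w.

(* Main.v *)
Require Import Defs.
From mathcomp Require Import all_boot all_order all_algebra.
From mathcomp Require Import all_classical all_reals all_analysis.
From mathcomp Require Import complex.
From mathcomp Require Import measurable_realfun ring lra zify.

(** Write [M = lam u u^T + H], [X] for the truncation of [H] at [B], and [D] for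
the maximum of [sigma sqrt (n log n)] and [B log n]. If [M x = al x] with
[|x| = 1], then [x = kappa u + (H / al) x] with [kappa] real, and iterating
gives [a^T (x - kappa u) = kappa sum_{1 <= s <= N} a^T (H / al)^s u + a^T (H / al)^(N+1) x],
while [||kappa| - 1| <= |H| / |al|]. So it is enough to bound [|a^T H^s u|] by
[sqrt (mu / n) (C D)^s] for [s <= N ~ log n], and [|H|] by [C D].

Both come from moments of order [m ~ log n]: of [a^T X^s u], and of
[tr ((X^T X)^J)]. A product of [m] entries indexed by a family of walks has mean
zero unless each edge occurs at least twice, and it is bounded by
[sigma^(2 l) B^(m - 2 l)], with [l] the number of distinct edges. A step opening
a new edge has at most [n] endpoints, and a step repeating an old one has at
most [m] choices, whence [(2 max (sigma sqrt (n m), m B))^m]. Since [X] is not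
symmetric, edges are directed: the starting vertex of a walk is determined by
the others when its first edge reappears inside a walk, and otherwise that edge
is shared by the starts of several walks, so that the weights [a] contribute
[sum_x a_x^2 = 1]; hence no power of [n] is lost for a general [a].

That the leading eigenvalue is real, of modulus at least [|lam| / 2], follows
from the intermediate value theorem applied to
[u^T adj (t - G) u - det (t - G)], [G = H / lam], and from the fact that an
invariant plane with a non-real eigenvalue would contain a nonzero vector
orthogonal to [u], where [M] acts as the small matrix [H]. *)

Set Implicit Arguments.
Unset Strict Implicit.
Unset Printing Implicit Defensive.

Import Order.TTheory GRing.Theory Num.Theory.
Import numFieldNormedType.Exports.

Local Open Scope ring_scope.

(** * Sums over labelled slots *)

Section Slots.
Variables (O S I : finType) (edge : O -> S -> I) (o : S -> nat).
Hypothesis o_inj : injective o.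

(** The representative of least rank among the slots reading the same edge. As a map it encodes this
    partition of the slots, and its fixed points are the slots that open a new edge. *)
Definition first_slot (w : O) : {ffun S -> S} :=
  [ffun t => [arg min_(t' < t | edge w t' == edge w t) o t']].

Definition doubled (w : O) : bool :=
  [forall t, exists t', (t' != t) && (edge w t' == edge w t)].

Lemma first_slot_edge w t : edge w (first_slot w t) = edge w t.
Proof. by rewrite ffunE; case: arg_minnP => // i /eqP. Qed.

Lemma first_slot_min w t t' :
  edge w t' = edge w t -> (o (first_slot w t) <= o t')%N.
Proof.
by rewrite ffunE; case: arg_minnP => // i /eqP _ imin e; apply: imin; apply/eqP.
Qed.

Lemma first_slot_eq w t t' :
  edge w t = edge w t' -> first_slot w t = first_slot w t'.
Proof.
move=> e; apply: o_inj; apply/eqP; rewrite eqn_leq !first_slot_min //.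
  by rewrite first_slot_edge.
by rewrite first_slot_edge.
Qed.

Lemma first_slotK w t : first_slot w (first_slot w t) = first_slot w t.
Proof. by apply: first_slot_eq; rewrite first_slot_edge. Qed.

Variable R : realFieldType.

Definition multiplicity (w : O) (e : I) : nat := #|[set t | edge w t == e]|.

(** Here [mu e j] is the [j]-th moment of the entry [e]. With [m] for [#|S|], a class of size
    [j + 2] has weight [D / n * (D / m) ^+ j.+1], at least [sigma2 * B ^+ j] because
    [n m sigma2 <= D^2] and [m B <= D]; a class of size one has moment zero. *)
Lemma edge_class_weight (mu : I -> nat -> R) (n sigma2 B D : R) :
  0 < n -> 0 <= sigma2 -> 0 <= B -> 0 <= D -> (0 < #|S|)%N ->
  n * #|S|%:R * sigma2 <= D ^+ 2 -> #|S|%:R * B <= D ->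
  (forall e, mu e 0 = 1) -> (forall e, mu e 1 = 0) ->
  (forall e j, `|mu e j.+2| <= sigma2 * B ^+ j) ->
  forall w e,
  `|mu e (multiplicity w e)| <=
    \prod_(t | edge w t == e)
       (if first_slot w t == t then D / n else D / #|S|%:R).
Proof.
move=> n0 s0 B0 D0 S0 Ds DB mu0 mu1 mu2 w e.
have m0 : 0 < #|S|%:R :> R by rewrite ltr0n.
have [[t0 t0e]|noe] := altP (@existsP _ (fun t => edge w t == e)); last first.
  rewrite big1 ?/multiplicity; last first.
    by move=> t te; case/negP: noe; apply/existsP; exists t.
  rewrite (_ : [set t | _] = finset.set0) ?cards0 ?mu0 ?normr1 //.
  apply/setP => t; rewrite !inE; apply/negP => te.
  by case/negP: noe; apply/existsP; exists t.
set r := first_slot w t0.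
have re : edge w r == e by rewrite first_slot_edge.
have rr : first_slot w r == r by rewrite first_slotK.
rewrite (bigD1 r) //= rr.
under eq_bigr => t /andP[/eqP te tr].
  rewrite (_ : first_slot w t == t = false); last first.
    apply/negbTE; apply: contra tr => /eqP <-; apply/eqP/first_slot_eq.
    by rewrite te (eqP t0e).
  over.
rewrite prodr_const.
have -> : multiplicity w e = #|[pred t | (edge w t == e) && (t != r)]|.+1.
  rewrite /multiplicity (cardsD1 r) inE re add1n; congr (_.+1).
  by apply: eq_card => t; rewrite !inE andbC.
case: #|[pred t | _]| => [|j].
  by rewrite mu1 normr0 expr0 mulr1 divr_ge0 // ltW.
apply: le_trans (mu2 e j) _.
rewrite exprS mulrA.
have b1 : B <= D / #|S|%:R by rewrite ler_pdivlMr // mulrC.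
apply: ler_pM => //; first exact: exprn_ge0.
  rewrite mulf_div -expr2 ler_pdivlMr ?mulr_gt0 //.
  by rewrite mulrC.
by apply: lerXn2r; rewrite ?nnegrE // divr_ge0 // ltW.
Qed.

(* Summing over the possible values [p] of [first_slot] costs a factor
   [\prod_t (D + (m - 1) D / m) <= (2 D)^m]: a slot opening a new edge class
   weighs [D], and a slot repeating an earlier one weighs [D / m], with [m]
   choices for the latter. *)
Lemma doubled_sum_bound (g : O -> R) (mu : I -> nat -> R) (n sigma2 B D G : R) :
  0 < n -> 0 <= sigma2 -> 0 <= B -> 0 <= D -> (0 < #|S|)%N ->
  n * #|S|%:R * sigma2 <= D ^+ 2 -> #|S|%:R * B <= D ->
  (forall e, mu e 0 = 1) -> (forall e, mu e 1 = 0) ->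
  (forall e j, `|mu e j.+2| <= sigma2 * B ^+ j) ->
  (forall p, \sum_(w | doubled w && (first_slot w == p)) `|g w| <=
     G * n ^+ #|[set t | p t == t]|) ->
  `|\sum_w g w * \prod_e mu e (multiplicity w e)| <= G * (2 * D) ^+ #|S|.
Proof.
move=> n0 s0 B0 D0 S0 Ds DB mu0 mu1 mu2 cnt.
have m0 : 0 < #|S|%:R :> R by rewrite ltr0n.
have ew := edge_class_weight n0 s0 B0 D0 S0 Ds DB mu0 mu1 mu2.
pose psi (p : {ffun S -> S}) t := if p t == t then D / n else D / #|S|%:R.
have psi0 p t : 0 <= psi p t by rewrite /psi; case: ifP => _; rewrite divr_ge0 // ltW.
have G0 : 0 <= G.
  have := cnt [ffun t => t].
  move=> /(le_trans _) h; have := h 0 (sumr_ge0 _ _).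
  by rewrite pmulr_lge0 ?exprn_gt0 //; apply.
have term w : `|g w * \prod_e mu e (multiplicity w e)| <=
    if doubled w then `|g w| * \prod_t psi (first_slot w) t else 0.
  rewrite normrM normr_prod; case: ifPn => [dw|].
    apply: ler_wpM2l => //.
    rewrite (partition_big (edge w) xpredT) //=.
    by apply: ler_prod => e _; rewrite normr_ge0 /=; apply: ew.
  rewrite negb_forall => /existsP[t]; rewrite negb_exists => /forallP ht.
  rewrite (bigD1 (edge w t)) //= (_ : multiplicity w _ = 1%N) ?mu1 ?normr0 ?mul0r ?mulr0 //.
  rewrite /multiplicity (_ : [set _ | _] = [set t]) ?cards1 //.
  apply/setP => t'; rewrite !inE; apply/eqP/eqP => [e|-> //].
  by apply/eqP; have := ht t'; rewrite e eqxx andbT negbK.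
apply: le_trans (ler_norm_sum _ _ _) _.
apply: le_trans (ler_sum _ (fun w _ => term w)) _.
rewrite -big_mkcond /= (partition_big first_slot xpredT) //=.
have -> : G * (2 * D) ^+ #|S| = G * \prod_(t : S) (2 * D).
  by rewrite prodr_const; congr (_ * _ ^+ _); apply: eq_card.
apply: (@le_trans _ _ (\sum_(p : {ffun S -> S})
    G * (\prod_t (if p t == t then D else D / #|S|%:R)))).
  apply: ler_sum => p _.
  rewrite (eq_bigr (fun w => `|g w| * \prod_t psi p t)); last first.
    by move=> w /andP[_ /eqP ->].
  rewrite -mulr_suml.
  apply: le_trans (ler_wpM2r _ (cnt p)) _; first exact: prodr_ge0.
  (* Each factor [n] of the count cancels the [1 / n] in the weight of one opening slot. *)
  rewrite -mulrA ler_wpM2l // le_eqVlt; apply/orP; left; apply/eqP.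
  rewrite cardsE -[_ ^+ _](@prodr_const R S) big_mkcond /= -big_split /=.
  apply: eq_bigr => t _; rewrite /psi (_ : (t \in _) = (p t == t)) //.
  case: ifP => _; last by rewrite mul1r.
  by rewrite mulrC divfK // gt_eqF.
rewrite -mulr_sumr ler_wpM2l //.
(* The sum over all maps [p] factorises into one sum per slot: [D] for the fixed value and at most
   [D] for the others together. *)
rewrite -(bigA_distr_bigA (fun t t' => if t' == t then D else D / #|S|%:R)) /=.
apply: ler_prod => t _; rewrite (bigD1 t) //= eqxx.
rewrite (eq_bigr (fun=> D / #|S|%:R)); last by move=> i /negbTE ->.
rewrite sumr_const.
have Dm : 0 <= D / #|S|%:R by rewrite divr_ge0 // ltW.
have : D / #|S|%:R *+ #|[pred i | i != t]| <= D.
  apply: (@le_trans _ _ (D / #|S|%:R *+ #|S|)).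
    rewrite -[leLHS]mulr_natr -[leRHS]mulr_natr ler_wpM2l // ler_nat.
    exact: max_card.
  by rewrite -mulr_natr divfK // gt_eqF.
have : 0 <= D / #|S|%:R *+ #|[pred i | i != t]| by rewrite mulrn_wge0.
rewrite (_ : #|_| = #|[pred i | i != t]|) //.
lra.
Qed.
End Slots.

(** * Walks *)

Definition walk (n s : nat) := {ffun 'I_s.+1 -> 'I_n}.

Section WalkExpansion.
Variables (R : comNzRingType) (n : nat).

(** The factors may vary, so that powers and the alternating products [H^T H H^T H ...] share one
    expansion over walks. *)
Fixpoint chain (A : nat -> 'M[R]_n) (s : nat) : 'M[R]_n :=
  if s is s'.+1 then A 0 *m chain (fun j => A j.+1) s' else 1%:M.

(** [F] weighs the two endpoints: [a x * u y] for a bilinear form, the Kronecker delta for a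
    trace. *)
Lemma chain_expand s (A : nat -> 'M[R]_n) (F : 'I_n -> 'I_n -> R) :
  \sum_x \sum_y F x y * chain A s x y =
  \sum_(w : walk n s) F (w ord0) (w ord_max) *
    \prod_(j < s) A j (w (widen_ord (leqnSn s) j)) (w (lift ord0 j)).
Proof.
elim: s A F => [|s IH] A F /=.
  rewrite (reindex (fun x : 'I_n => [ffun => x] : walk n 0)) /=; last first.
    exists (fun w : walk n 0 => w ord0) => [x _|w _]; first by rewrite ffunE.
    by apply/ffunP => i; rewrite ffunE; congr (w _); case: i => -[|//] ?; exact/val_inj.
  apply: eq_bigr => x _; rewrite big_ord0 mulr1 !ffunE (bigD1 x) //= big1.
    by rewrite mxE eqxx mulr1 addr0.
  by move=> y yx; rewrite mxE eq_sym (negbTE yx) mulr0.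
pose cons (xw : 'I_n * walk n s) : walk n s.+1 :=
  [ffun j => if unlift ord0 j is Some j' then xw.2 j' else xw.1].
have cons0 x w : cons (x, w) ord0 = x by rewrite ffunE unlift_none.
have consS x w j : cons (x, w) (lift ord0 j) = w j by rewrite ffunE liftK.
rewrite [RHS](reindex cons) /=; last first.
  exists (fun w => (w ord0, [ffun j => w (lift ord0 j)])) => [[x w] _|w _].
    by rewrite cons0; congr pair; apply/ffunP => j; rewrite ffunE consS.
  apply/ffunP => j; rewrite ffunE; case: unliftP => [j' ->|->] //.
  by rewrite ffunE.
rewrite -(pair_bigA _ (fun x w => F (cons (x, w) ord0) (cons (x, w) ord_max) *
  \prod_(j < s.+1) A j (cons (x, w) (widen_ord (leqnSn s.+1) j)) (cons (x, w) (lift ord0 j)))) /=.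
apply: eq_bigr => x _.
transitivity (\sum_z \sum_y (F x y * A 0 x z) * chain (fun j => A j.+1) s z y).
  rewrite exchange_big /=; apply: eq_bigr => y _; rewrite mxE mulr_sumr.
  by apply: eq_bigr => z _; rewrite mulrA.
rewrite (IH _ (fun z y => F x y * A 0 x z)); apply: eq_bigr => w _.
rewrite cons0 (_ : ord_max = lift ord0 ord_max); last exact/val_inj.
rewrite consS big_ord_recl consS -!mulrA; congr (_ * (A 0 _ _ * _)).
  by rewrite (_ : widen_ord _ _ = ord0) ?cons0 //; exact/val_inj.
apply: eq_bigr => j _.
rewrite (_ : widen_ord _ _ = lift ord0 (widen_ord (leqnSn s) j)) ?consS //.
exact/val_inj.
Qed.

End WalkExpansion.

(** * Counting families of walks weighted at their starting vertices *)

Section LinearFormCount.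
Variables (R : realFieldType) (n k s : nat).
Let slot := ('I_k * 'I_s.+1)%type.

(** Slot [(r, j)] is step [j] of walk [r]; the [k] walks come from the [k]-th power of a bilinear
    form. *)
Definition walks_edge (W : {ffun 'I_k -> walk n s.+1}) (t : slot) : 'I_n * 'I_n :=
  (W t.1 (widen_ord (leqnSn s.+1) t.2), W t.1 (lift ord0 t.2)).

Variable o : slot -> nat.
Hypothesis o_inj : injective o.

Let fs := first_slot walks_edge o.

(** Given the pattern [p], the endpoints of the opening slots, [n] choices each, determine every
    vertex except the starts. A start is known as soon as the first edge of its walk also occurs
    inside some walk. Otherwise at least two walks share that first edge and its source [x], which
    therefore carries at most [a x ^+ 2]; summed over [x] this costs a factor at most 1 and no power
    of [n]. *)
Lemma linear_form_count (a : 'I_n -> R) (p : {ffun slot -> slot}) :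
  \sum_x a x ^+ 2 <= 1 ->
  \sum_(W | doubled walks_edge W && (fs W == p)) \prod_r `|a (W r ord0)| <=
    n%:R ^+ #|[set t | p t == t]|.
Proof.
move=> a1.
have aL x : `|a x| <= 1.
  rewrite -(@expr_le1 _ 2) // real_normK ?num_real //; apply: le_trans a1.
  by rewrite (bigD1 x) //= lerDl sumr_ge0 // => i _; exact: sqr_ge0.
case: (posnP n) => [n0|n0].
  have I0 (i : 'I_n) : False by case: i => i; rewrite n0.
  case: (posnP k) => [k0|k0]; last first.
    rewrite big1 ?exprn_ge0 // => W _.
    by case: (I0 (W (Ordinal k0) ord0)).
  have S0 (t : slot) : False by case: t => -[r kr] _; rewrite k0 in kr.
  rewrite (_ : [set t | _] = finset.set0) ?cards0 ?expr0; last first.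
    by apply/setP => t; case: (S0 t).
  apply: (@le_trans _ _ (\sum_(W : {ffun 'I_k -> walk n s.+1}) 1)).
    rewrite big_mkcond; apply: ler_sum => W _; case: ifP => // _.
    by apply: prodr_ile1 => r _; rewrite normr_ge0 /=.
  rewrite sumr_const card_ffun card_ord.
  by rewrite [X in (_ ^ X)%N]k0 expn0.
(* [x0] is the value stored where no choice is made, so that [dst] and [src] range over functions
   supported on the fixed points of [p] and on [rep]. *)
pose x0 : 'I_n := Ordinal n0.
pose slot1 (r : 'I_k) : slot := (r, ord0).
(* The walks whose first edge represents a class made of first edges only. *)
pose rep (r : 'I_k) := (p (slot1 r) == slot1 r) &&
  [forall t : slot, (p t == slot1 r) ==> (t.2 == ord0)].
pose dst (W : {ffun 'I_k -> walk n s.+1}) : {ffun slot -> 'I_n} :=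
  [ffun t => if p t == t then W t.1 (lift ord0 t.2) else x0].
pose src (W : {ffun 'I_k -> walk n s.+1}) : {ffun 'I_k -> 'I_n} :=
  [ffun r => if rep r then W r ord0 else x0].
pose good := [set W | doubled walks_edge W && (fs W == p)].
have pE W : W \in good -> forall t, walks_edge W (p t) = walks_edge W t.
  by rewrite inE => /andP[_ /eqP <-] t; exact: first_slot_edge.
have ppE W : W \in good -> forall t, p (p t) = p t.
  by rewrite inE => /andP[_ /eqP <-] t; exact: first_slotK.
have dstE W : W \in good -> forall r j, W r (lift ord0 j) = dst W (p (r, j)).
  move=> gW r j; rewrite ffunE (ppE _ gW) eqxx.
  by case: (pE _ gW (r, j)).
have srcE W : W \in good -> forall t, W t.1 (widen_ord (leqnSn s.+1) t.2) =
    W (p t).1 (widen_ord (leqnSn s.+1) (p t).2).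
  by move=> gW t; case: (pE _ gW t).
have w0 : widen_ord (leqnSn s.+1) ord0 = ord0 by exact/val_inj.
have inj : {in good &, injective (fun W => (dst W, src W))}.
  move=> W W' gW gW' [ed es].
  have inner r j : W r (lift ord0 j) = W' r (lift ord0 j).
    by rewrite !dstE // ed.
  apply/ffunP => r; apply/ffunP => i; case: (unliftP ord0 i) => [j ->|->] //.
  (* If the first edge of walk [r] is also a later step of some walk, the start of [r] equals an
     inner vertex, already recovered from [dst]. *)
  case/boolP: [exists t : slot, (p t == p (slot1 r)) && (t.2 != ord0)].
    move=> /existsP[t /andP[/eqP pt t2]].
    have := srcE _ gW (slot1 r); have := srcE _ gW' (slot1 r).
    rewrite /= w0 -pt -!srcE // => -> ->.
    case: (unliftP ord0 t.2) t2 => [j tj _|->]; last by rewrite eqxx.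
    rewrite tj (_ : widen_ord _ _ = lift ord0 (widen_ord (leqnSn s) j)) //.
    exact/val_inj.
  rewrite negb_exists => /forallP no.
  have := no (p (slot1 r)); rewrite (ppE _ gW) eqxx /= negbK => /eqP q2.
  have q : p (slot1 r) = slot1 (p (slot1 r)).1.
    by rewrite [LHS]surjective_pairing q2.
  have rp : rep (p (slot1 r)).1.
    rewrite /rep -q (ppE _ gW) eqxx; apply/forallP => t; apply/implyP => tq.
    by have := no t; rewrite tq /= negbK.
  have := srcE _ gW (slot1 r); have := srcE _ gW' (slot1 r).
  rewrite /= q2 w0 => -> ->.
  by move/ffunP/(_ (p (slot1 r)).1): es; rewrite !ffunE rp.
have wt W : W \in good ->
    \prod_r `|a (W r ord0)| <= \prod_(r | rep r) a (src W r) ^+ 2.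
  move=> gW.
  rewrite (partition_big (fun r => (p (slot1 r)).1) xpredT) //=.
  rewrite [leRHS]big_mkcond; apply: ler_prod => r _.
  rewrite prodr_ge0 //=; case: ifPn => [rr|_]; last first.
    by apply: prodr_ile1 => r' _; rewrite normr_ge0 /=.
  have [/eqP pr /forallP ro] := andP rr.
  (* Doubling provides a second slot in the class; it is the first edge of another walk with the
     same start, whence the square. *)
  have [t tn te] : exists2 t, t != slot1 r & p t = slot1 r.
    move: (gW); rewrite inE => /andP[/forallP/(_ (slot1 r))/existsP[t]].
    move=> /andP[tn /eqP te] /eqP fsp; exists t => //.
    by rewrite -pr -fsp; apply: first_slot_eq.
  have t2 : t.2 = ord0 by apply/eqP/(implyP (ro t)); rewrite te.
  have tE : t = slot1 t.1 by rewrite [LHS]surjective_pairing t2.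
  have t1r : t.1 != r by apply: contra tn => /eqP <-; rewrite -tE.
  rewrite (bigD1 r) ?pr //= (bigD1 t.1) /=; last by rewrite -tE te eqxx.
  have -> : W t.1 ord0 = W r ord0.
    by have := srcE _ gW t; rewrite te /= t2 w0.
  rewrite ffunE rr mulrA -expr2 real_normK ?num_real //.
  rewrite ler_piMr ?sqr_ge0 //.
  by apply: prodr_ile1 => r' _; rewrite normr_ge0 /=.
rewrite (eq_bigl (fun W => W \in good)); last by move=> W; rewrite inE.
apply: le_trans (ler_sum _ wt) _.
pose G (x : {ffun slot -> 'I_n} * {ffun 'I_k -> 'I_n}) :=
  \prod_(r | rep r) a (x.2 r) ^+ 2.
have G0 x : 0 <= G x by apply: prodr_ge0 => r _; exact: sqr_ge0.
(* By injectivity, the sum over families is at most the sum over all pairs of choices, which then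
   factorises. *)
rewrite (eq_bigr (fun W => G (dst W, src W))) // -(big_imset G inj) /=.
apply: (@le_trans _ _ (\sum_(x | (x.1 \in pffun_on x0 [pred t | p t == t] predT) &&
   (x.2 \in pffun_on x0 rep predT)) G x)).
  rewrite big_mkcond [leRHS]big_mkcond; apply: ler_sum => x _.
  case: ifP => [/imsetP[W gW ->]|_]; last by case: ifP.
  rewrite /= ifT //; apply/andP; split; apply/pffun_onP.
    split; first by apply/supportP => t ht; rewrite ffunE; apply: ifN; exact: ht.
    by [].
  split; first by apply/supportP => t ht; rewrite ffunE; apply: ifN; exact: ht.
  by [].
rewrite -(pair_big (fun x => x \in pffun_on x0 [pred t | p t == t] predT)
  (fun y => y \in pffun_on x0 rep predT) (fun x y => G (x, y))) /=.
rewrite /G /= sumr_const -(big_distr_big x0 rep xpredT (fun _ x => a x ^+ 2)) /=.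
rewrite card_pffun_on cardsE.
rewrite (_ : #|[eta xpredT]| = n); last by rewrite -[RHS]card_ord; apply: eq_card.
rewrite -natrX.
rewrite -[leLHS]mulr_natr ler_piMl ?ler0n //.
by apply: prodr_ile1 => r _; rewrite a1 sumr_ge0 // => i _; exact: sqr_ge0.
Qed.
End LinearFormCount.

(** * Counting walks for traces of powers of [H^T H] *)

Section ClosedWalkCount.
Variables (R : realFieldType) (n m : nat).

(* The entry of [H] read by the [t]-th factor of the product [H^T H H^T H ...]. *)
Definition alternating_edge (w : walk n m) (t : 'I_m) : 'I_n * 'I_n :=
  if odd t then (w (widen_ord (leqnSn m) t), w (lift ord0 t))
  else (w (lift ord0 t), w (widen_ord (leqnSn m) t)).

(** The walk is rebuilt in order of time: [n] choices for the start and for each step opening an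
    edge. A repeating step reads the edge of an earlier step, whose two ends are known, and one of
    them is its new vertex. *)
Lemma alternating_count (p : {ffun 'I_m -> 'I_m}) :
  (#|[set w | first_slot alternating_edge (@nat_of_ord m) w == p]| <=
     n * n ^ #|[set t | p t == t]|)%N.
Proof.
case: (posnP n) => [n0|n0].
  have I0 (i : 'I_n) : False by case: i => i; rewrite n0.
  rewrite (_ : [set w | _] = finset.set0) ?cards0 //; apply/setP => w.
  by case: (I0 (w ord0)).
pose x0 : 'I_n := Ordinal n0.
set good := [set w | _].
pose dst (w : walk n m) : {ffun 'I_m -> 'I_n} :=
  [ffun t => if p t == t then w (lift ord0 t) else x0].
have inj : {in good &, injective (fun w : walk n m => (w ord0, dst w))}.
  move=> w w' gw gw' [e0 /ffunP ed].
  have H i (hi : (i < m.+1)%N) : w (Ordinal hi) = w' (Ordinal hi).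
    elim/ltn_ind: i hi => -[|i] IH hi.
      by rewrite (_ : Ordinal hi = ord0) //; exact/val_inj.
    pose t : 'I_m := Ordinal (hi : (i < m)%N).
    rewrite (_ : Ordinal hi = lift ord0 t); last exact/val_inj.
    have [pt|pt] := eqVneq (p t) t.
      by have := ed t; rewrite !ffunE pt eqxx.
    have lept : (p t < t)%N.
      rewrite ltn_neqAle; apply/andP; split; first exact: pt.
      by move: gw; rewrite inE => /eqP <-; apply: first_slot_min.
    have := first_slot_edge alternating_edge (@nat_of_ord m) w t.
    have := first_slot_edge alternating_edge (@nat_of_ord m) w' t.
    move: gw gw'; rewrite !inE => /eqP -> /eqP ->.
    have hi2 : (i < m.+1)%N by exact: ltnW.
    have e1 : w (widen_ord (leqnSn m) t) = w' (widen_ord (leqnSn m) t).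
      by rewrite (_ : widen_ord _ _ = Ordinal hi2) ?IH //; exact/val_inj.
    have e2 : w (widen_ord (leqnSn m) (p t)) = w' (widen_ord (leqnSn m) (p t)).
      have h : (p t < m.+1)%N by apply: ltnW; rewrite ltnS.
      rewrite (_ : widen_ord _ _ = Ordinal h) ?IH //; last exact/val_inj.
      by rewrite ltnS ltnW.
    have e3 : w (lift ord0 (p t)) = w' (lift ord0 (p t)).
      have h : ((p t).+1 < m.+1)%N by rewrite ltnS.
      by rewrite (_ : lift _ _ = Ordinal h) ?IH //; exact/val_inj.
    rewrite /alternating_edge.
    (* Equal parities traverse the edge in the same direction, so the new vertex is the end of the
       earlier step; opposite parities give its origin. *)
    case: (odd t); case: (odd (p t)) => h1 h2; case: h1 => a1 a2; case: h2 => b1 b2.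
    - exact: etrans (esym b2) (etrans e3 a2).
    - exact: etrans (esym b2) (etrans e2 a2).
    - exact: etrans (esym b1) (etrans e2 a1).
    - exact: etrans (esym b1) (etrans e3 a1).
  by apply/ffunP => i; case: i => i hi.
rewrite -(card_in_imset inj).
apply: (@leq_trans #|predX (predT : pred 'I_n) (mem (pffun_on x0 [pred t | p t == t] predT))|).
  apply: subset_leq_card; apply/fintype.subsetP => x /imsetP[w gw ->].
  rewrite inE /=; apply/pffun_onP; split=> //.
  by apply/supportP => t ht; rewrite ffunE; apply: ifN; exact: ht.
rewrite cardX card_pffun_on cardsE.
rewrite (_ : #|predT| = n); last by rewrite -[RHS]card_ord; apply: eq_card.
rewrite leq_mul2l; apply/orP; right.
by apply: eq_leq; congr (_ ^ _)%N; apply: eq_card.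
Qed.
End ClosedWalkCount.

Local Open Scope classical_set_scope.
Local Open Scope ring_scope.

(** * Bounded random variables *)

Section BoundedMeasurable.
Context d (T : measurableType d) (R : realType).
Implicit Types f g : T -> R.

Definition bmeas f := measurable_fun setT f /\ exists M, forall x, `|f x| <= M.

Lemma bmeas_cst (c : R) : bmeas (fun=> c).
Proof. by split; [exact: measurable_cst|exists `|c|]. Qed.

Lemma bmeasD f g : bmeas f -> bmeas g -> bmeas (fun x => f x + g x).
Proof.
move=> [mf [M Mf]] [mg [N Ng]]; split; first exact: measurable_funD.
by exists (M + N) => x; apply: le_trans (ler_normD _ _) _; exact: lerD.
Qed.

Lemma bmeasM f g : bmeas f -> bmeas g -> bmeas (fun x => f x * g x).
Proof.
move=> [mf [M Mf]] [mg [N Ng]]; split; first exact: measurable_funM.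
by exists (M * N) => x; rewrite normrM; exact: ler_pM.
Qed.

Lemma bmeasX f k : bmeas f -> bmeas (fun x => f x ^+ k).
Proof.
move=> bf; elim: k => [|k IH]; first exact: (bmeas_cst 1).
by under [X in bmeas X]funext do rewrite exprS; exact: bmeasM.
Qed.

Lemma bmeas_sum (I : Type) (s : seq I) (h : I -> T -> R) :
  (forall i, bmeas (h i)) -> bmeas (fun x => \sum_(i <- s) h i x).
Proof.
move=> bh; elim: s => [|i s IH].
  by under [X in bmeas X]funext do rewrite big_nil; exact: bmeas_cst.
by under [X in bmeas X]funext do rewrite big_cons; exact: bmeasD.
Qed.

Lemma bmeas_prod (I : Type) (s : seq I) (P : pred I) (h : I -> T -> R) :
  (forall i, bmeas (h i)) -> bmeas (fun x => \prod_(i <- s | P i) h i x).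
Proof.
move=> bh; elim: s => [|i s IH].
  by under [X in bmeas X]funext do rewrite big_nil; exact: bmeas_cst.
under [X in bmeas X]funext do rewrite big_cons.
by case: (P i) => //; exact: bmeasM.
Qed.

Lemma bmeas_indic (A : set T) : measurable A -> bmeas \1_A.
Proof.
move=> mA; split; first exact: measurable_indic.
by exists 1 => x; rewrite indicE ger0_norm ?ler0n // lern1; case: (_ \in _).
Qed.

(** The range [[-M, M]] is cut into intervals of length [e], and [f] is replaced by the left end of
    the interval containing its value. *)
Lemma bmeas_step (f : T -> R) : bmeas f -> forall e, 0 < e ->
  exists (K : nat) (c : 'I_K -> R) (A : 'I_K -> set T),
    (forall k, measurable (A k)) /\
    (forall x, `|f x - \sum_k c k * \1_(A k) x| <= e).
Proof.
move=> [mf [M Mf]] e e0.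
(* The successor adds the interval that contains the right end [M]. *)
pose K := (Num.truncn (2 * M / e)).+1.
pose A (k : 'I_K) : set T := f @^-1` `[- M + k%:R * e, - M + k.+1%:R * e[%classic.
exists K, (fun k : 'I_K => - M + k%:R * e), A; split.
  by move=> k; rewrite -[A k]setTI; apply: mf => //; exact: measurable_itv.
move=> x; have /andP[fM1 fM2] : - M <= f x <= M by rewrite -ler_norml.
pose y := (f x + M) / e.
have y0 : 0 <= y by apply: divr_ge0; [lra|exact: ltW].
have yK : (Num.truncn y < K)%N.
  by rewrite ltnS; apply: le_truncn; rewrite ler_pM2r ?invr_gt0 //; lra.
have /andP[ty1 ty2] := truncn_itv y0.
have yE : f x = - M + y * e by rewrite /y divfK ?gt_eqF //; ring.
have hk1 : (Num.truncn y)%:R * e <= y * e by rewrite ler_pM2r.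
have hk2 : y * e < (Num.truncn y).+1%:R * e by rewrite ltr_pM2r.
rewrite (bigD1 (Ordinal yK)) //= big1 ?addr0 => [|k kn].
  rewrite indicE mem_set /A /= ?in_itv /= ?mulr1; last first.
    by rewrite yE !lerD2l ltrD2l hk1 hk2.
  rewrite yE ger0_norm; last by lra.
  by move: hk2; rewrite -natr1 mulrDl mul1r; lra.
rewrite indicE memNset ?mulr0 // /A /= in_itv /= => /andP[k1 k2].
case/negP: kn; apply/eqP/val_inj => /=; apply/esym/truncn_def.
rewrite -(ler_pM2r e0) -(ltr_pM2r e0).
by move: k1 k2; rewrite {1 2}yE !lerD2l ltrD2l => -> ->.
Qed.

End BoundedMeasurable.

(** * Expectation and independence *)

Section Expectation.
Context d (T : measurableType d) (R : realType) (P : probability T R).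
Implicit Types f g : T -> R.

Definition Ex f : R := \int[P]_x f x.

Lemma bmeas_integrable f : bmeas f -> P.-integrable setT (EFin \o f).
Proof.
move=> [mf [M Mf]]; apply: measurable_bounded_integrable => //.
  exact: fin_num_fun_lty.
exists M; split; first exact: num_real.
by move=> x Mx t _; apply: le_trans (Mf t) (ltW Mx).
Qed.

Lemma ExD f g : bmeas f -> bmeas g -> Ex (fun x => f x + g x) = Ex f + Ex g.
Proof. by move=> bf bg; rewrite /Ex RintegralD //; exact: bmeas_integrable. Qed.

Lemma ExZ (c : R) f : bmeas f -> Ex (fun x => c * f x) = c * Ex f.
Proof. by move=> bf; rewrite /Ex RintegralZl //; exact: bmeas_integrable. Qed.

Lemma Ex_cst (c : R) : Ex (fun=> c) = c.
Proof. by rewrite /Ex Rintegral_cst // [X in fine X]probability_setT mulr1. Qed.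

Lemma Ex_sum (I : Type) (s : seq I) (h : I -> T -> R) :
  (forall i, bmeas (h i)) ->
  Ex (fun x => \sum_(i <- s) h i x) = \sum_(i <- s) Ex (h i).
Proof.
move=> bh; elim: s => [|i s IH].
  by under [X in Ex X]funext do rewrite big_nil; rewrite Ex_cst big_nil.
under [X in Ex X]funext do rewrite big_cons.
by rewrite ExD ?IH ?big_cons //; exact: bmeas_sum.
Qed.

Lemma le_Ex f g : bmeas f -> bmeas g -> (forall x, f x <= g x) -> Ex f <= Ex g.
Proof. by move=> bf bg fg; apply: le_Rintegral => //; exact: bmeas_integrable. Qed.

Lemma norm_Ex_le f M : bmeas f -> (forall x, `|f x| <= M) -> `|Ex f| <= M.
Proof.
move=> bf fM; have h x : - M <= f x <= M by rewrite -ler_norml.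
rewrite ler_norml -[X in X <= _](Ex_cst (- M)) -[X in _ && (_ <= X)](Ex_cst M).
apply/andP; split; apply: le_Ex => // [|x]; try exact: bmeas_cst;
  by case/andP: (h x).
Qed.

Lemma Ex_indic (A : set T) : measurable A -> Ex \1_A = fine (P A).
Proof. by move=> mA; rewrite /Ex /Rintegral integral_indic // setIT. Qed.

Lemma markov_bmeas f c (A : set T) : bmeas f -> 0 <= c -> measurable A ->
  (forall x, 0 <= f x) -> (forall x, A x -> c <= f x) -> c * fine (P A) <= Ex f.
Proof.
move=> bf c0 mA f0 Af; rewrite -Ex_indic // -ExZ; last exact: bmeas_indic.
apply: le_Ex => //; first by apply: bmeasM; [exact: bmeas_cst|exact: bmeas_indic].
move=> x; rewrite indicE; case: (boolP (x \in A)) => [/set_mem/Af|_].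
  by rewrite mulr1.
by rewrite mulr0.
Qed.

Lemma bmeas_comp (X : {RV P >-> R}) (phi : R -> R) :
  bmeas phi -> bmeas (fun w => phi (X w)).
Proof.
move=> [mphi [M Mphi]]; split; last by exists M => x.
exact: measurableT_comp.
Qed.

(* Both sides are linear and sup-norm continuous in [phi], and step functions
   are dense for the sup norm. *)
Lemma factor_of_indicators (X : {RV P >-> R}) (G : T -> R) (c : R) :
  bmeas G ->
  (forall A, measurable A ->
     Ex (fun w => \1_A (X w) * G w) = Ex (fun w => \1_A (X w)) * c) ->
  forall phi, bmeas phi ->
     Ex (fun w => phi (X w) * G w) = Ex (fun w => phi (X w)) * c.
Proof.
move=> bG HA phi bphi; have [_ [M MG]] := bG.
have bXA A : measurable A -> bmeas (fun w => \1_A (X w) : R).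
  by move=> mA; apply: bmeas_comp; exact: bmeas_indic.
have key e : 0 < e -> `|Ex (fun w => phi (X w) * G w) - Ex (fun w => phi (X w)) * c|
    <= e * (M + `|c|).
  move=> e0; have [K [co [A [mA Hs]]]] := bmeas_step bphi e0.
  pose psi x := \sum_k co k * \1_(A k) x.
  have bpsi : bmeas psi.
    apply: bmeas_sum => k; apply: bmeasM; first exact: bmeas_cst.
    exact: bmeas_indic.
  have bd : bmeas (fun x => phi x + -1 * psi x).
    by apply: bmeasD => //; apply: bmeasM => //; exact: bmeas_cst.
  have psiE : Ex (fun w => psi (X w) * G w) = Ex (fun w => psi (X w)) * c.
    under [X in Ex X = _]funext do rewrite /psi mulr_suml.
    rewrite Ex_sum; last first.
      move=> k; do 2 apply: bmeasM => //; first exact: bmeas_cst.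
      exact: bXA.
    rewrite /psi Ex_sum; last first.
      by move=> k; apply: bmeasM; [exact: bmeas_cst|exact: bXA].
    rewrite mulr_suml; apply: eq_bigr => k _.
    under [X in Ex X = _]funext do rewrite -mulrA.
    rewrite ExZ; last by apply: bmeasM => //; exact: bXA.
    by rewrite HA // ExZ ?mulrA //; exact: bXA.
  have e1 : Ex (fun w => phi (X w) * G w) =
     Ex (fun w => (phi (X w) + -1 * psi (X w)) * G w) + Ex (fun w => psi (X w) * G w).
    rewrite -ExD; last 2 first.
    - by apply: bmeasM => //; exact: (bmeas_comp X bd).
    - by apply: bmeasM => //; exact: bmeas_comp.
    by congr Ex; apply/funext => w; ring.
  have e2 : Ex (fun w => phi (X w)) =
     Ex (fun w => phi (X w) + -1 * psi (X w)) + Ex (fun w => psi (X w)).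
    rewrite -ExD; last 2 first.
    - exact: (bmeas_comp X bd).
    - exact: bmeas_comp.
    by congr Ex; apply/funext => w; ring.
  rewrite e1 e2 psiE mulrDl opprD addrACA subrr addr0 mulrDr.
  have h x : `|phi x + -1 * psi x| <= e by rewrite mulN1r; exact: Hs.
  apply: le_trans (ler_normB _ _) _; apply: lerD.
    apply: norm_Ex_le; first by apply: bmeasM => //; exact: (bmeas_comp X bd).
    by move=> w; rewrite normrM; apply: ler_pM.
  rewrite normrM ler_wpM2r //; apply: norm_Ex_le => //.
  exact: (bmeas_comp X bd).
apply/eqP; rewrite -subr_eq0 -normr_le0; apply/ler_addgt0Pr => e e0.
rewrite add0r.
have M0 : 0 <= M by apply: le_trans (MG point).
have MC : 0 < M + `|c| + 1 by have := normr_ge0 c; lra.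
apply: le_trans (key (e / (M + `|c| + 1)) _) _; first by rewrite divr_gt0.
rewrite mulrAC ler_pdivrMr // ler_wpM2l ?ltW //; lra.
Qed.

(** Independence is given for events, that is for products of indicators. The induction is on a list
    [K] outside which all factors are indicators: [factor_of_indicators] passes from an indicator to
    a general bounded factor, one index at a time. *)
Lemma Ex_prod_indep (I : finType) (X : I -> {RV P >-> R}) (f : I -> R -> R) :
  mutually_independent X -> (forall i, bmeas (f i)) ->
  Ex (fun w => \prod_i f i (X i w)) = \prod_i Ex (fun w => f i (X i w)).
Proof.
move=> indX; suff H (K : seq I) : forall f : I -> R -> R, (forall i, bmeas (f i)) ->
    (forall i, i \notin K -> exists2 A, measurable A & f i = \1_A) ->
    Ex (fun w => \prod_i f i (X i w)) = \prod_i Ex (fun w => f i (X i w)).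
  by move=> bf; apply: (H (enum I)) => // i; rewrite mem_enum.
elim: K => [|i K IH] {}f bf fK.
  have /choice [A AP] : forall i, exists A, measurable A /\ f i = \1_A.
    by move=> i; case: (fK i) => // A mA ->; exists A.
  have mXA i : measurable (X i @^-1` A i).
    by rewrite -[X in measurable X]setTI; apply: measurable_funPT => //; exact: (AP i).1.
  have -> : (fun w => \prod_i f i (X i w)) =
      \1_[set w | forall i, i \in [set: I]%SET -> A i (X i w)].
    apply/funext => w; rewrite indicE; under eq_bigr do rewrite (AP _).2 indicE.
    case: (boolP (w \in _)) => [/set_mem h|/negP h].
      by apply: big1 => i _; rewrite mem_set //; apply: h; rewrite inE.
    have [i hi] : exists i, ~ A i (X i w).
      by apply/existsNP => h'; apply: h; apply/mem_set => i _; exact: h'.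
    by rewrite (bigD1 i) //= memNset // mul0r.
  rewrite Ex_indic; last first.
    rewrite (_ : [set _ | _] = \bigcap_(i in [set: I]) (X i @^-1` A i)).
      apply: fin_bigcap_measurable => //; exact: finite_finset.
    by apply/seteqP; split => w h i // _; apply: h => //; rewrite ?inE.
  rewrite (indX [set: I]%SET A); last by move=> i _; exact: (AP i).1.
  under [RHS]eq_bigr => i _.
    have -> : (fun w => f i (X i w)) = \1_(X i @^-1` A i).
      by apply/funext => w; rewrite (AP i).2 !indicE.
    rewrite Ex_indic //; over.
  rewrite [in LHS](eq_bigl xpredT); last by move=> i; rewrite finset.in_setT.
  have PE i : P (X i @^-1` A i) = (fine (P (X i @^-1` A i)))%:E.
    by rewrite fineK // fin_num_measure.
  under eq_bigr do rewrite PE.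
  by rewrite prodEFin.
set c := \prod_(j | j != i) Ex (fun w => f j (X j w)).
rewrite [RHS](bigD1 i) //= -/c.
under [X in Ex X = _]funext do rewrite (bigD1 i) //=.
apply: (@factor_of_indicators (X i) (fun w => \prod_(j | j != i) f j (X j w))).
- by apply: bmeas_prod => j; exact: bmeas_comp.
- move=> A mA; pose f' j : R -> R := if j == i then \1_A else f j.
  have f'i : f' i = \1_A by rewrite /f' eqxx.
  have f'j j : j != i -> f' j = f j by rewrite /f' => /negbTE ->.
  have := IH f'; rewrite [in X in _ -> _ -> _ = X](bigD1 i) //= f'i => h.
  rewrite /c (eq_bigr (fun j => Ex (fun w => f' j (X j w)))); last first.
    by move=> j /f'j ->.
  rewrite -h.
  + congr Ex; apply/funext => w; rewrite [RHS](bigD1 i) //= f'i; congr (_ * _).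
    by apply: eq_bigr => j /f'j ->.
  + move=> j; have [->|/f'j -> //] := eqVneq j i.
    by rewrite f'i; exact: bmeas_indic.
  + move=> j jK; have [->|ji] := eqVneq j i; first by exists A.
    by rewrite f'j //; apply: fK; rewrite inE negb_or ji.
- exact: bf.
Qed.
End Expectation.

(** * Moments of random matrices *)

Section Chains.
Variables (R : comNzRingType) (n : nat).

Lemma chain_const (M : 'M[R]_n) s : chain (fun=> M) s = M ^+ s.
Proof. by elim: s => [|s IH] //=; rewrite IH exprS. Qed.

Definition alternating (M : 'M[R]_n) (j : nat) := if odd j then M else M^T.

Lemma chain_alternating (M : 'M[R]_n) J :
  chain (alternating M) J.*2 = (M^T *m M) ^+ J.
Proof.
elim: J => [|J IH] //=.
rewrite (_ : (fun j => alternating M j.+2) = alternating M).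
  by rewrite IH exprS mulmxA.
by apply/funext => j; rewrite /alternating /= negbK.
Qed.

Lemma trmx_pow_sym (A : 'M[R]_n) K : A^T = A -> (A ^+ K)^T = A ^+ K.
Proof.
move=> sA; elim: K => [|K IH]; first exact: trmx1.
by rewrite exprS -mulmxE trmx_mul sA IH mulmxE -exprSr exprS.
Qed.

(** The trace of an even power is a squared Frobenius norm: nonnegative, as Markov's inequality
    requires, and above the squared operator norm of [A ^+ K]. *)
Lemma trace_pow_double (A : 'M[R]_n) K : A^T = A ->
  \tr (A ^+ K.*2) = \sum_i \sum_j (A ^+ K) i j ^+ 2.
Proof.
move=> sA; rewrite -addnn exprD; apply: eq_bigr => i _; rewrite mxE.
by apply: eq_bigr => j _; rewrite -{2}(trmx_pow_sym K sA) mxE expr2.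
Qed.

Lemma trmx_gram (M : 'M[R]_n) : (M^T *m M)^T = M^T *m M.
Proof. by rewrite trmx_mul trmxK. Qed.
End Chains.

(** * Moment and tail bounds for bilinear forms and traces *)

Section Moments.
Context d (T : measurableType d) (R : realType) (P : probability T R).
Local Notation Ex := (Ex P).

(** Independence is recorded as the factorisation of mixed moments, the form in which the expansion
    over walks consumes it. *)
Definition centred_bounded (I : finType) (sigma2 B : R) (X : I -> T -> R) :=
  [/\ forall e, bmeas (X e), forall e w, `|X e w| <= B,
      forall e, Ex (X e) = 0, forall e, Ex (fun w => X e w ^+ 2) <= sigma2 &
      forall m : I -> nat, Ex (fun w => \prod_e X e w ^+ m e) =
                           \prod_e Ex (fun w => X e w ^+ m e)].

Lemma norm_Ex (f g : T -> R) : bmeas f -> bmeas g ->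
  (forall w, `|f w| <= g w) -> `|Ex f| <= Ex g.
Proof.
move=> bf bg fg; have h w : - g w <= f w <= g w by rewrite -ler_norml.
rewrite ler_norml -mulN1r -ExZ //; apply/andP; split; apply: le_Ex => //.
- by apply: bmeasM => //; exact: bmeas_cst.
- by move=> w; rewrite mulN1r; case/andP: (h w).
- by move=> w; case/andP: (h w).
Qed.

(** Grouping the factors by edge turns each expectation into a product of moments, and [X ^+ j.+2]
    is at most [B ^+ j * X ^+ 2] in absolute value. *)
Lemma moment_bound (I : finType) (sigma2 B : R) (X : I -> T -> R)
    (O S : finType) (edge : O -> S -> I) (o : S -> nat) (g : O -> R) (n D G : R) :
  centred_bounded sigma2 B X -> injective o ->
  0 < n -> 0 <= sigma2 -> 0 <= B -> 0 <= D -> (0 < #|S|)%N ->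
  n * #|S|%:R * sigma2 <= D ^+ 2 -> #|S|%:R * B <= D ->
  (forall p, \sum_(w | doubled edge w && (first_slot edge o w == p)) `|g w| <=
     G * n ^+ #|[set t | p t == t]%SET|) ->
  Ex (fun w => \sum_y g y * \prod_t X (edge y t) w) <= G * (2 * D) ^+ #|S|.
Proof.
move=> [bX XB X0 X2 Xind] oi n0 s0 B0 D0 S0 Ds DB cnt.
pose mu e j := Ex (fun w => X e w ^+ j).
have h := @doubled_sum_bound O S I edge o oi R g mu n sigma2 B D G
  n0 s0 B0 D0 S0 Ds DB _ _ _ cnt.
apply: le_trans (le_trans (ler_norm _) (h _ _ _)).
- rewrite Ex_sum; last first.
    by move=> y; apply: bmeasM; [exact: bmeas_cst|apply: bmeas_prod => t].
  apply: ler_sum => y _; rewrite ExZ; last by apply: bmeas_prod => t.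
  rewrite le_eqVlt; apply/orP; left; apply/eqP; congr (_ * _).
  rewrite -Xind; congr (Ex _); apply/funext => w.
  rewrite (partition_big (edge y) xpredT) //=; apply: eq_bigr => e _.
  rewrite (eq_bigr (fun=> X e w)); last by move=> t /eqP ->.
  by rewrite prodr_const /multiplicity cardsE.
- by move=> e; rewrite /mu; under [X in Ex X]funext do rewrite expr0; exact: Ex_cst.
- by move=> e; rewrite /mu; under [X in Ex X]funext do rewrite expr1.
- move=> e j; rewrite /mu.
  apply: (@le_trans _ _ (Ex (fun w => B ^+ j * X e w ^+ 2))).
    apply: norm_Ex; first exact: bmeasX.
      by apply: bmeasM; [exact: bmeas_cst|exact: bmeasX].
    move=> w; rewrite normrX -addn2 exprD real_normK ?num_real //.
    rewrite ler_wpM2r ?sqr_ge0 //; apply: lerXn2r; rewrite ?nnegrE //.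
  by rewrite ExZ ?(mulrC sigma2) ?ler_wpM2l ?exprn_ge0 //; exact: bmeasX.
Qed.

Variables (n : nat) (sigma2 B : R) (X : 'I_n * 'I_n -> T -> R).
Hypothesis cbX : centred_bounded sigma2 B X.
Hypothesis n_gt0 : (0 < n)%N.
Hypothesis sigma2_ge0 : 0 <= sigma2.
Hypothesis B_ge0 : 0 <= B.

Definition rmatrix (w : T) : 'M[R]_n := \matrix_(i, j) X (i, j) w.

Lemma bilinear_expand (a u : 'cV[R]_n) s w :
  (a^T *m rmatrix w ^+ s *m u) 0 0 =
  \sum_(v : walk n s) a (v ord0) 0 * u (v ord_max) 0 *
    \prod_(j < s) X (v (widen_ord (leqnSn s) j), v (lift ord0 j)) w.
Proof.
transitivity (\sum_x \sum_y (a x 0 * u y 0) * (rmatrix w ^+ s) x y).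
  rewrite mxE exchange_big /=; apply: eq_bigr => y _.
  rewrite mxE mulr_suml; apply: eq_bigr => x _; rewrite mxE; ring.
rewrite -chain_const (chain_expand _ _ (fun x y => a x 0 * u y 0)).
by apply: eq_bigr => v _; congr (_ * _); apply: eq_bigr => j _; rewrite mxE.
Qed.

Lemma bilinear_power_expand (a u : 'cV[R]_n) s k w :
  (a^T *m rmatrix w ^+ s.+1 *m u) 0 0 ^+ k =
  \sum_(W : {ffun 'I_k -> walk n s.+1})
    (\prod_r (a (W r ord0) 0 * u (W r ord_max) 0)) *
    \prod_t X (walks_edge W t) w.
Proof.
rewrite bilinear_expand -[in LHS](card_ord k) -prodr_const bigA_distr_bigA /=.
apply: eq_bigr => W _; rewrite big_split /=; congr (_ * _).
by rewrite pair_bigA.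
Qed.

Lemma trace_expand J w :
  \tr (((rmatrix w)^T *m rmatrix w) ^+ J) =
  \sum_(v : walk n J.*2) (v ord0 == v ord_max)%:R *
    \prod_t X (alternating_edge v t) w.
Proof.
rewrite -chain_alternating.
transitivity (\sum_x \sum_y (x == y)%:R * chain (alternating (rmatrix w)) J.*2 x y).
  apply: eq_bigr => x _; rewrite (bigD1 x) //= eqxx mul1r big1 ?addr0 // => y yx.
  by rewrite eq_sym (negbTE yx) mul0r.
rewrite (chain_expand _ _ (fun x y => (x == y)%:R)).
apply: eq_bigr => v _; congr (_ * _); apply: eq_bigr => j _.
by rewrite /alternating /alternating_edge; case: odd; rewrite !mxE.
Qed.

Lemma bmeas_bilinear_power (a u : 'cV[R]_n) s k :
  bmeas (fun w => (a^T *m rmatrix w ^+ s.+1 *m u) 0 0 ^+ k).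
Proof.
have [bX _ _ _ _] := cbX.
under [X in bmeas X]funext do rewrite bilinear_power_expand.
apply: bmeas_sum => W; apply: bmeasM; first exact: bmeas_cst.
by apply: bmeas_prod.
Qed.

Lemma bmeas_trace J : bmeas (fun w => \tr (((rmatrix w)^T *m rmatrix w) ^+ J)).
Proof.
have [bX _ _ _ _] := cbX.
under [X in bmeas X]funext do rewrite trace_expand.
apply: bmeas_sum => W; apply: bmeasM; first exact: bmeas_cst.
by apply: bmeas_prod.
Qed.

(** The final vertices contribute [b ^+ k] through the sup bound on [u], the initial ones are
    handled by [linear_form_count]. *)
Lemma bilinear_moment (a u : 'cV[R]_n) (b D : R) s k :
  \sum_i a i 0 ^+ 2 <= 1 -> (forall i, `|u i 0| <= b) -> 0 <= D -> (0 < k)%N ->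
  n%:R * (k * s.+1)%:R * sigma2 <= D ^+ 2 -> (k * s.+1)%:R * B <= D ->
  Ex (fun w => (a^T *m rmatrix w ^+ s.+1 *m u) 0 0 ^+ k) <=
  b ^+ k * (2 * D) ^+ (k * s.+1).
Proof.
move=> a1 ub D0 k0 Ds DB.
under [X in Ex X]funext do rewrite bilinear_power_expand.
have cS : #|{: 'I_k * 'I_s.+1}| = (k * s.+1)%N by rewrite card_prod !card_ord.
have b0 : 0 <= b by apply: le_trans (ub (Ordinal n_gt0)).
rewrite -cS; pose o (t : 'I_k * 'I_s.+1) := nat_of_ord (enum_rank t).
have oi : injective o by move=> x y /val_inj /enum_rank_inj.
apply: (@moment_bound _ sigma2 B X _ _ (@walks_edge n k s) o _ n%:R) => //.
- by rewrite ltr0n.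
- by rewrite cS muln_gt0 k0.
- by rewrite cS.
- by rewrite cS.
move=> p.
apply: (@le_trans _ _ (b ^+ k *
   \sum_(W | doubled (@walks_edge n k s) W && (first_slot (@walks_edge n k s) o W == p))
      \prod_r `|a (W r ord0) 0|)).
  rewrite mulr_sumr; apply: ler_sum => W _; rewrite normr_prod.
  under eq_bigr do rewrite normrM.
  rewrite big_split /= mulrC ler_wpM2r ?prodr_ge0 //.
  rewrite -[X in b ^+ X](card_ord k) -prodr_const.
  by apply: ler_prod => r _; rewrite normr_ge0 ub.
rewrite ler_wpM2l ?exprn_ge0 //.
exact: (@linear_form_count R n k s o oi (fun i => a i 0)).
Qed.

Lemma trace_moment (D : R) J : 0 <= D -> (0 < J)%N ->
  n%:R * (J.*2)%:R * sigma2 <= D ^+ 2 -> (J.*2)%:R * B <= D ->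
  Ex (fun w => \tr (((rmatrix w)^T *m rmatrix w) ^+ J)) <= n%:R * (2 * D) ^+ J.*2.
Proof.
move=> D0 J0 Ds DB.
under [X in Ex X]funext do rewrite trace_expand.
rewrite -[X in _ ^+ X](card_ord J.*2).
apply: (@moment_bound _ sigma2 B X _ _ (@alternating_edge n J.*2) (@nat_of_ord J.*2) _ n%:R) => //.
- exact: val_inj.
- by rewrite ltr0n.
- by rewrite card_ord double_gt0.
- by rewrite card_ord.
- by rewrite card_ord.
move=> p.
apply: (@le_trans _ _
  (#|[set w : walk n J.*2 |
        first_slot (@alternating_edge n J.*2) (@nat_of_ord _) w == p]%SET|)%:R);
  last first.
  by rewrite -natrX -natrM ler_nat; exact: alternating_count.
rewrite -sum1_card natr_sum big_mkcond [leRHS]big_mkcond; apply: ler_sum => v _.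
rewrite inE; case: (first_slot _ _ _ == p); rewrite ?andbF // andbT.
by case: ifP => _ //; rewrite ger0_norm ?ler0n // lern1; case: (_ == _).
Qed.

(** Markov's inequality for the [k]-th power, [k] even: the threshold uses [4 * D] and the moment
    [2 * D], which leaves a factor 2 for each step of the walks. *)
Lemma bilinear_tail (a u : 'cV[R]_n) (b D : R) s k :
  \sum_i a i 0 ^+ 2 <= 1 -> (forall i, `|u i 0| <= b) -> 0 < b -> 0 < D ->
  (0 < k)%N -> ~~ odd k ->
  n%:R * (k * s.+1)%:R * sigma2 <= D ^+ 2 -> (k * s.+1)%:R * B <= D ->
  let A := [set w | b * (4 * D) ^+ s.+1 <= `|(a^T *m rmatrix w ^+ s.+1 *m u) 0 0|] in
  measurable A /\ fine (P A) <= 2 ^- (k * s.+1).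
Proof.
move=> a1 ub b0 D0 k0 ek Ds DB A.
have [m1 _] := bmeas_bilinear_power a u s 1.
have mA : measurable A.
  rewrite /A (_ : [set _ | _] = (fun w => `|(a^T *m rmatrix w ^+ s.+1 *m u) 0 0|)
     @^-1` `[b * (4 * D) ^+ s.+1, +oo[%classic).
    rewrite -[X in measurable X]setTI.
    by apply: (measurableT_comp (@normr_measurable R setT)) => //; exact: measurable_itv.
  by apply/seteqP; split => w; rewrite /= in_itv /= andbT.
split => //.
pose c := (b * (4 * D) ^+ s.+1) ^+ k.
have c0 : 0 < c by rewrite /c !(exprn_gt0, mulr_gt0).
have pow0 (x : R) : 0 <= x ^+ k.
  by rewrite -(odd_double_half k) (negbTE ek) add0n -mul2n exprM exprn_ge0 ?sqr_ge0.
have h : c * fine (P A) <= b ^+ k * (2 * D) ^+ (k * s.+1).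
  apply: le_trans (bilinear_moment a1 ub (ltW D0) k0 Ds DB).
  apply: markov_bmeas => //; [exact: bmeas_bilinear_power|exact: ltW|].
  move=> w Aw; rewrite -[leRHS]ger0_norm // normrX.
  by rewrite lerXn2r // nnegrE ltW // !(exprn_gt0, mulr_gt0).
have e1 : 0 < b ^+ k * (2 * D) ^+ (k * s.+1) by rewrite !(exprn_gt0, mulr_gt0).
rewrite -(ler_pM2l e1) ler_pdivlMr ?exprn_gt0 //; apply: le_trans h.
rewrite le_eqVlt; apply/orP; left; apply/eqP.
rewrite /c (_ : 4 * D = 2 * (2 * D)); last by ring.
rewrite [(b * _) ^+ k]exprMn -exprM [(s.+1 * k)%N]mulnC.
by rewrite [(2 * (2 * D)) ^+ _]exprMn; ring.
Qed.

Lemma trace_tail (D : R) K : 0 < D -> (0 < K)%N ->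
  n%:R * (K.*2.*2)%:R * sigma2 <= D ^+ 2 -> (K.*2.*2)%:R * B <= D ->
  let A := [set w | (4 * D) ^+ K.*2.*2 <= \tr (((rmatrix w)^T *m rmatrix w) ^+ K.*2)] in
  measurable A /\ fine (P A) <= n%:R * 2 ^- K.*2.*2.
Proof.
move=> D0 K0 Ds DB A.
have bt := bmeas_trace K.*2; have [mt _] := bt.
have mA : measurable A.
  rewrite /A (_ : [set _ | _] =
     (fun w => \tr (((rmatrix w)^T *m rmatrix w) ^+ K.*2))
       @^-1` `[(4 * D) ^+ K.*2.*2, +oo[%classic).
    by rewrite -[X in measurable X]setTI; apply: mt => //; exact: measurable_itv.
  by apply/seteqP; split => w; rewrite /= in_itv /= andbT.
split => //.
have h : (4 * D) ^+ K.*2.*2 * fine (P A) <= n%:R * (2 * D) ^+ K.*2.*2.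
  apply: le_trans (trace_moment (ltW D0) _ Ds DB); last by rewrite double_gt0.
  apply: markov_bmeas => //; first by rewrite exprn_ge0 // mulr_ge0 // ltW.
  move=> w; rewrite trace_pow_double ?trmx_gram //.
  by apply: sumr_ge0 => i _; apply: sumr_ge0 => j _; exact: sqr_ge0.
have e1 : 0 < (2 * D) ^+ K.*2.*2 by rewrite exprn_gt0 // mulr_gt0.
rewrite -(ler_pM2l e1) mulrA ler_pdivlMr ?exprn_gt0 //.
rewrite [leRHS]mulrC; apply: le_trans h.
rewrite le_eqVlt; apply/orP; left; apply/eqP.
rewrite (_ : 4 * D = 2 * (2 * D)); last by ring.
by rewrite [(2 * (2 * D)) ^+ _]exprMn; ring.
Qed.
End Moments.

(** * Euclidean and operator norms *)

Section Euclidean.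
Variables (R : realType) (n : nat).
Implicit Types (x y z : 'cV[R]_n) (M A : 'M[R]_n).

Definition dot x y : R := (x^T *m y) 0 0.

Lemma dotE x y : dot x y = \sum_i x i 0 * y i 0.
Proof. by rewrite /dot mxE; apply: eq_bigr => i _; rewrite mxE. Qed.

Lemma dotC x y : dot x y = dot y x.
Proof. by rewrite !dotE; apply: eq_bigr => i _; rewrite mulrC. Qed.

Lemma dotDr x y z : dot x (y + z) = dot x y + dot x z.
Proof. by rewrite /dot mulmxDr mxE. Qed.

Lemma dotZr x (c : R) y : dot x (c *: y) = c * dot x y.
Proof. by rewrite /dot -scalemxAr mxE. Qed.

Lemma dotDl x y z : dot (y + z) x = dot y x + dot z x.
Proof. by rewrite dotC dotDr !(dotC x). Qed.

Lemma dotZl x (c : R) y : dot (c *: y) x = c * dot y x.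
Proof. by rewrite dotC dotZr dotC. Qed.

Lemma dotNr x y : dot x (- y) = - dot x y.
Proof. by rewrite -scaleN1r dotZr mulN1r. Qed.

Lemma dotNl x y : dot (- y) x = - dot y x.
Proof. by rewrite dotC dotNr dotC. Qed.

Lemma dot_mulmx M x y : dot (M *m x) y = dot x (M^T *m y).
Proof. by rewrite /dot trmx_mul mulmxA. Qed.

Lemma dot_ge0 x : 0 <= dot x x.
Proof. by rewrite dotE; apply: sumr_ge0 => i _; rewrite -expr2 sqr_ge0. Qed.

Lemma dot_eq0 x : dot x x = 0 -> x = 0.
Proof.
rewrite dotE => /eqP; rewrite psumr_eq0 => [/allP h|i _]; last by rewrite -expr2 sqr_ge0.
apply/colP => i; rewrite mxE; apply/eqP.
by have := h i (mem_index_enum i); rewrite /= -expr2 sqrf_eq0.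
Qed.

Lemma l2normE x : l2norm x = Num.sqrt (dot x x).
Proof. by rewrite /l2norm dotE; congr Num.sqrt; apply: eq_bigr => i _; rewrite expr2. Qed.

Lemma sqr_l2norm x : l2norm x ^+ 2 = dot x x.
Proof. by rewrite l2normE sqr_sqrtr // dot_ge0. Qed.

Lemma l2norm_ge0 x : 0 <= l2norm x.
Proof. exact: sqrtr_ge0. Qed.

Lemma l2norm_eq0 x : l2norm x = 0 -> x = 0.
Proof. by move=> h; apply: dot_eq0; rewrite -sqr_l2norm h expr0n. Qed.

Lemma l2normZ (c : R) x : l2norm (c *: x) = `|c| * l2norm x.
Proof. by rewrite !l2normE dotZl dotZr mulrA -expr2 sqrtrM ?sqr_ge0 // sqrtr_sqr. Qed.

Lemma l2normN x : l2norm (- x) = l2norm x.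
Proof. by rewrite -scaleN1r l2normZ normrN1 mul1r. Qed.

(** Cauchy-Schwarz, from the nonnegative squared norm of [dot y y *: x - dot x y *: y]. *)
Lemma sqr_dot_le x y : dot x y ^+ 2 <= dot x x * dot y y.
Proof.
have [/dot_eq0 ->|y0] := eqVneq (dot y y) 0.
  by rewrite -(scale0r 0) dotZr dotZr !mul0r mulr0 expr0n.
have yp : 0 < dot y y by rewrite lt_neqAle eq_sym y0 dot_ge0.
have := dot_ge0 (dot y y *: x - dot x y *: y).
rewrite !(dotDl, dotDr, dotNl, dotNr, dotZl, dotZr) (dotC y x) => h.
rewrite -subr_ge0 -(pmulr_rge0 _ yp); apply: le_trans h _.
by rewrite le_eqVlt; apply/orP; left; apply/eqP; ring.
Qed.

Lemma dot_le x y : `|dot x y| <= l2norm x * l2norm y.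
Proof.
rewrite -(@ler_pXn2r _ 2) ?nnegrE ?mulr_ge0 ?l2norm_ge0 //.
by rewrite real_normK ?num_real // exprMn !sqr_l2norm sqr_dot_le.
Qed.

Lemma l2normD x y : l2norm (x + y) <= l2norm x + l2norm y.
Proof.
rewrite -(@ler_pXn2r _ 2) ?nnegrE ?addr_ge0 ?l2norm_ge0 //.
rewrite sqr_l2norm !(dotDl, dotDr) (dotC y x).
have := le_trans (ler_norm _) (dot_le x y).
rewrite sqrrD !sqr_l2norm; lra.
Qed.

Lemma l2normB x y : `|l2norm x - l2norm y| <= l2norm (x - y).
Proof.
have h1 := l2normD (x - y) y; rewrite subrK in h1.
have h2 := l2normD (y - x) x; rewrite subrK -opprB l2normN in h2.
rewrite ler_norml; lra.
Qed.

Definition op_bound M (h : R) := forall x, l2norm (M *m x) <= h * l2norm x.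

Lemma op_boundX M h x s : 0 <= h -> op_bound M h ->
  l2norm (M ^+ s *m x) <= h ^+ s * l2norm x.
Proof.
move=> h0 Mh; elim: s => [|s IH]; first by rewrite mul1mx mul1r.
rewrite exprS -mulmxE -mulmxA; apply: le_trans (Mh _) _.
by rewrite exprS -mulrA ler_wpM2l.
Qed.

(** For symmetric [A] and unit [x], [<x, A x>^2 <= |A x|^2 = <x, A^2 x>]; the step is iterated on
    [A^2]. This restricts the exponents to powers of two. *)
Lemma dot_sym_pow2 A x j : A^T = A -> dot x x = 1 ->
  0 <= dot x (A *m x) -> dot x (A *m x) ^+ (2 ^ j) <= dot x (A ^+ (2 ^ j) *m x).
Proof.
move=> + x1; elim: j A => [|j IH] A sA p0; first by rewrite expr1 expr1.
have e : dot x (A ^+ 2 *m x) = dot (A *m x) (A *m x).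
  by rewrite dot_mulmx sA expr2 -mulmxE mulmxA.
rewrite expnS !exprM.
have c : dot x (A *m x) ^+ 2 <= dot x (A ^+ 2 *m x).
  by rewrite e; apply: le_trans (sqr_dot_le _ _) _; rewrite x1 mul1r.
apply: le_trans (IH _ _ _); last 2 first.
- by rewrite trmx_pow_sym.
- by rewrite e dot_ge0.
by apply: lerXn2r => //; rewrite nnegrE ?sqr_ge0 // e dot_ge0.
Qed.

(** With [A = M^T M], [x] a unit vector and [K = 2^j], [|M x|^(4K) = <x, A x>^(2K) <= <x, A^(2K) x>
    = |A^K x|^2], and this is at most the squared Frobenius norm of [A^K], which is the trace of
    [A^(2K)]. *)
Lemma op_bound_trace M (h : R) j : 0 <= h ->
  \tr ((M^T *m M) ^+ (2 ^ j).*2) <= h ^+ (2 ^ j).*2.*2 -> op_bound M h.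
Proof.
move=> h0 tr_le; have unit_case x : dot x x = 1 -> dot (M *m x) (M *m x) <= h ^+ 2.
  move=> x1; set A := M^T *m M in tr_le.
  have sA : A^T = A by exact: trmx_gram.
  have e : dot (M *m x) (M *m x) = dot x (A *m x) by rewrite dot_mulmx mulmxA.
  have p0 : 0 <= dot x (A *m x) by rewrite -e dot_ge0.
  have N0 : (0 < (2 ^ j).*2)%N by rewrite double_gt0 expn_gt0.
  rewrite -(@ler_pXn2r _ (2 ^ j).*2) ?nnegrE ?dot_ge0 ?exprn_ge0 // e.
  rewrite -exprM mul2n; apply: le_trans tr_le.
  have := dot_sym_pow2 j.+1 sA x1 p0; rewrite expnS mul2n => /le_trans; apply.
  rewrite trace_pow_double // -{1}addnn exprD -mulmxE -mulmxA.
  rewrite -{1}(trmx_pow_sym (2 ^ j) sA) -dot_mulmx dotE; apply: ler_sum => i _.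
  rewrite -expr2 mxE.
  have := sqr_dot_le ((row i (A ^+ (2 ^ j)))^T) x; rewrite x1 mulr1 !dotE.
  rewrite (eq_bigr (fun k => (A ^+ (2 ^ j)) i k * x k 0)); last by move=> k _; rewrite !mxE.
  move=> /le_trans; apply; rewrite le_eqVlt; apply/orP; left; apply/eqP.
  by apply: eq_bigr => k _; rewrite !mxE expr2.
move=> x; have [x0|x0] := eqVneq (l2norm x) 0.
  by rewrite (l2norm_eq0 x0) mulmx0 (_ : l2norm 0 = 0) ?mulr0 // -(scale0r 0) l2normZ normr0 mul0r.
have xp : 0 < l2norm x by rewrite lt_neqAle eq_sym x0 l2norm_ge0.
have := unit_case ((l2norm x)^-1 *: x) _.
rewrite dotZl dotZr -sqr_l2norm -scalemxAr dotZl dotZr -(sqr_l2norm (M *m x)).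
rewrite expr2 mulKf // mulVf // => /(_ erefl).
rewrite mulrA -invfM -expr2 mulrC ler_pdivrMr ?exprn_gt0 // -exprMn.
by rewrite ler_pXn2r // nnegrE ?mulr_ge0 ?l2norm_ge0.
Qed.

End Euclidean.

(** * Rank-one perturbations *)

Lemma poly_ivt_mul (R : rcfType) (p : {poly R}) (a b : R) :
  a <= b -> p.[a] * p.[b] <= 0 -> exists2 x, a <= x <= b & root p x.
Proof.
move=> ab pab; have [pa|pa] := lerP p.[a] 0; have [pb|pb] := lerP p.[b] 0.
- have [pa0|pa0] := eqVneq p.[a] 0.
    by exists a; rewrite ?lexx ?ab // rootE pa0.
  have pan : p.[a] < 0 by rewrite lt_neqAle pa0.
  exists b; rewrite ?lexx ?ab // rootE eq_le pb /=.
  by rewrite -(nmulr_rle0 _ pan).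
- by apply: (@Num.poly_ivt R) => //; rewrite pa ltW.
- have [||x hx rx] := @Num.poly_ivt R (- p) a b => //.
    by rewrite !hornerN oppr_le0 oppr_ge0 (ltW pa) pb.
  by exists x; rewrite // -rootN.
- by have := mulr_gt0 pa pb; rewrite ltNge pab.
Qed.

(** * Real inequalities for the spectral estimates *)

Section ScalarBounds.
Variable R : realFieldType.
Implicit Types a b c h l p q s t : R.

(** For [v = (t - G)^-1 u], [p] is the norm of [v] and [s] is [<u, v>]: [t - c] exceeds one third,
    so [p <= 3] and the error is at most 3/64. *)
Lemma resolvent_scalar c t p s : 0 <= c <= 64^-1 -> 0 <= p -> 2^-1 <= t ->
  p * (t - c) <= 1 -> `|t * s - 1| <= c * p -> `|t * s - 1| <= 16^-1.
Proof.
move=> /andP[c0 c64] p0 t2 pt /le_trans; apply.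
have p3 : p <= 3.
  have : p * 3^-1 <= p * (t - c) by apply: ler_wpM2l => //; lra.
  lra.
by apply: (@le_trans _ _ (64^-1 * 3)); [exact: ler_pM|lra].
Qed.

(** Here and in [two_dim_scalar1] all letters stand for squares: [a] for the squared modulus of the
    eigenvalue, [l] for [lam^2], [h] for the squared noise bound, [p] and [q] for squared norms. In
    the two lemmas after that, [a] and [b] are the absolute values of the real and imaginary parts,
    and [h] is the noise bound itself. *)
Lemma two_dim_scalar0 a h l p q (d e : R) :
  a * (p + q) = d + e -> d <= h * p -> e <= h * q -> 0 < p + q ->
  64 ^+ 2 * h <= l -> l <= 4 * a -> 0 < l -> False.
Proof.
move=> E dp eq pq hl la l0.
have : a * (p + q) <= h * (p + q) by rewrite E mulrDr; exact: lerD.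
rewrite ler_pM2r //; lra.
Qed.

Lemma two_dim_scalar1 a h l p q (d e : R) :
  a * (p + q) = d + e -> d <= 2 * l + 2 * (h * p) -> e <= h * q ->
  0 <= p -> 0 <= q -> 64 ^+ 2 * h <= l -> l <= 4 * a -> 0 < l -> 0 <= h ->
  p + q <= 9.
Proof.
move=> E dp eq p0 q0 hl la l0 h0.
have pq : 0 <= p + q by rewrite addr_ge0.
have h1 : l * (p + q) <= 4 * a * (p + q) by exact: ler_wpM2r.
have h2 : 64 ^+ 2 * h * (p + q) <= l * (p + q) by exact: ler_wpM2r.
have h3 : 0 <= h * q by rewrite mulr_ge0.
rewrite -(ler_pM2l l0); lra.
Qed.

Lemma two_dim_scalar2 a b h p q : 0 < q -> 0 <= p -> p <= 3 -> q <= 3 ->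
  0 <= h -> b <= h * q -> a * q <= h * q + b * p -> 0 <= b ->
  a <= 4 * h /\ b <= 3 * h.
Proof.
move=> q0 p0 p3 q3 h0 bq aq b0.
have b1 : b * p <= h * q * 3 by apply: ler_pM.
have b2 : h * q <= h * 3 by exact: ler_wpM2l.
split; last by lra.
rewrite -(ler_pM2r q0); lra.
Qed.

Lemma two_dim_scalar3 a b h l : 0 <= a <= 4 * h -> 0 <= b <= 3 * h ->
  64 ^+ 2 * h ^+ 2 <= l -> 0 < l -> l <= 4 * (a ^+ 2 + b ^+ 2) -> False.
Proof.
move=> /andP[a0 a4] /andP[b0 b3] hl l0.
have : a ^+ 2 <= (4 * h) ^+ 2 by apply: lerXn2r; rewrite ?nnegrE //; lra.
have : b ^+ 2 <= (3 * h) ^+ 2 by apply: lerXn2r; rewrite ?nnegrE //; lra.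
rewrite !exprMn; lra.
Qed.

Lemma geometric_scalar (x y b r : R) : 0 <= b -> x <= 2 * b * y -> y <= 2 * r ->
  x <= 4 * b * r.
Proof.
move=> b0 xy yr; apply: le_trans xy _.
have := ler_wpM2l b0 yr; lra.
Qed.

Lemma final_scalar (b r d e : R) : 0 <= b -> 0 <= d -> 0 <= e -> r <= 2 * e ->
  5 * b * r + r * d <= 10 * (d + b) * e.
Proof.
move=> b0 d0 e0 re.
have := ler_wpM2l b0 re; have := ler_wpM2r d0 re; have := mulr_ge0 d0 e0; lra.
Qed.

End ScalarBounds.

(** * Eigenvalues and eigenvectors of a rank-one matrix plus small noise *)

Section Spectral.
Variables (R : realType) (n : nat).
Implicit Types (x y z u : 'cV[R]_n) (M H G : 'M[R]_n).

Lemma rank_one_mul u x : (u *m u^T) *m x = dot u x *: u.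
Proof. by rewrite -mulmxA [u^T *m x]mx11_scalar mul_mx_scalar. Qed.

Lemma horner_char_poly_mx G (t : R) :
  map_mx (horner_eval t) (char_poly_mx G) = t%:M - G.
Proof.
apply/matrixP => i j; rewrite !mxE /horner_eval !(hornerE, hornerMn).
by case: (i == j); rewrite ?hornerX ?horner0 ?mulr1n ?mulr0n.
Qed.

(** The vector [v t = (t - G)^-1 u] is an eigenvector for [t] as soon as [<u, v t> = 1]. Since
    [<u, v t>] is close to [1 / t], it passes through 1 between 1/2 and 3/2. *)
Lemma rank_one_eigenvalue u G (c : R) : dot u u = 1 -> op_bound G c ->
  0 <= c <= 64^-1 ->
  exists (t : R) (v : 'cV[R]_n), [/\ 2^-1 <= t, v != 0 & (u *m u^T + G) *m v = t *: v].
Proof.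
move=> u1 Gc /andP[c0 c64].
have nu : l2norm u = 1 by rewrite l2normE u1 sqrtr1.
have det0 t : 2^-1 <= t -> \det (t%:M - G) != 0.
  move=> t2; apply/negP; rewrite -det_tr => /det0P[v v0 hv]; have := congr1 (@trmx R 1 n) hv.
  rewrite trmx_mul trmxK trmx0 mulmxBl mul_scalar_mx => /eqP; rewrite subr_eq0 => /eqP tv.
  have := Gc v^T; rewrite -tv l2normZ ger0_norm; last by lra.
  have w0 : 0 < l2norm v^T.
    rewrite lt_neqAle l2norm_ge0 andbT eq_sym; apply: contra v0 => /eqP/l2norm_eq0 h.
    by rewrite -[v]trmxK h trmx0.
  by rewrite ler_pM2r //; lra.
pose w t := \adj (t%:M - G) *m u.
pose v t := (\det (t%:M - G))^-1 *: w t.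
have vE t : 2^-1 <= t -> t *: v t = u + G *m v t.
  move=> t2; apply/eqP; rewrite -subr_eq -mul_scalar_mx -mulmxBl; apply/eqP.
  rewrite /v -scalemxAr /w mulmxA mul_mx_adj mul_scalar_mx scalerA mulVf ?scale1r //.
  exact: det0.
have vn t : 2^-1 <= t -> l2norm (v t) * (t - c) <= 1.
  move=> t2; have := congr1 (@l2norm R n) (vE t t2); rewrite l2normZ ger0_norm; last by lra.
  move=> e; have := l2normD u (G *m v t); rewrite -e nu; have := Gc (v t); lra.
have uv t : 2^-1 <= t -> `|t * dot u (v t) - 1| <= c * l2norm (v t).
  move=> t2; rewrite -dotZr vE // dotDr u1 addrAC subrr add0r.
  by apply: le_trans (dot_le _ _) _; rewrite nu mul1r.
pose U := map_mx (@polyC R) u.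
(* Multiplying [<u, v t> - 1] by the determinant gives a polynomial in [t], to which the
   intermediate value theorem applies. *)
pose F := (U^T *m \adj (char_poly_mx G) *m U) 0 0 - char_poly G.
have qE t : (char_poly G).[t] = \det (t%:M - G).
  by rewrite -horner_char_poly_mx det_map_mx.
have FE t : 2^-1 <= t -> F.[t] = \det (t%:M - G) * (dot u (v t) - 1).
  move=> t2; rewrite /F hornerD hornerN qE mulrBr mulr1; congr (_ - _).
  rewrite /v dotZr mulrA divff ?det0 // mul1r /w /dot mulmxA.
  have UE : map_mx (horner_eval t) U = u.
    by apply/colP => i; rewrite !mxE /horner_eval hornerC.
  transitivity ((map_mx (horner_eval t) (U^T *m \adj (char_poly_mx G) *m U)) 0 0).
    by rewrite [RHS]mxE.
  by rewrite !map_mxM -map_trmx map_mx_adj /= UE horner_char_poly_mx.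
have h12 : (2^-1 : R) <= 3 / 2 by lra.
(* Were this product not positive, the characteristic polynomial would have a root in the interval,
   where [t - G] is nonsingular. *)
have qs : 0 < (char_poly G).[2^-1] * (char_poly G).[3 / 2].
  rewrite ltNge; apply/negP => /(poly_ivt_mul h12)[x /andP[x2 _]].
  by rewrite rootE qE => /eqP; apply/eqP; exact: det0.
have c064 : 0 <= c <= 64^-1 by rewrite c0.
have uv16 t : 2^-1 <= t -> `|t * dot u (v t) - 1| <= 16^-1.
  move=> t2.
  exact: (resolvent_scalar c064 (l2norm_ge0 (v t)) t2 (vn t t2) (uv t t2)).
have p1 : 0 < dot u (v 2^-1) - 1.
  have := uv16 2^-1 (lexx _); rewrite ler_norml => /andP[]; move: (dot u _) => z; clear; lra.
have p2 : 0 < 1 - dot u (v (3 / 2)).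
  have := uv16 (3/2) h12; rewrite ler_norml => /andP[]; move: (dot u _) => z; clear; lra.
have [t /andP[t2 _] rt] : exists2 t, 2^-1 <= t <= 3/2 & root F t.
  apply: poly_ivt_mul => //; rewrite !FE // -!qE.
  have := mulr_gt0 qs (mulr_gt0 p1 p2); rewrite -oppr_ge0 => /ltW/le_trans; apply.
  move: (dot u _) (dot u _) (_.[_]) (_.[_]) => z1 z2 z3 z4.
  by rewrite le_eqVlt; apply/orP; left; apply/eqP; ring.
move: rt; rewrite rootE FE // mulf_eq0 (negbTE (det0 _ t2)) /= subr_eq0 => /eqP uvt.
exists t, (v t); split => //.
  by apply/eqP => v0; move: uvt; rewrite v0 -(scale0r 0) dotZr mul0r => /eqP;
    rewrite eq_sym oner_eq0.
by rewrite mulmxDl rank_one_mul uvt scale1r -vE.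
Qed.

(** [x] and [y] are the real and imaginary parts of an eigenvector for [al + i be]. Rotating and
    scaling it makes [<u, q> = 0] for the imaginary part [q], so that [M q = H q] is small; unless
    [q = 0], both [al] and [be] are then of order [h], too small for a leading eigenvalue. *)
Lemma leading_real (lam h al be : R) u H x y :
  let M := lam *: (u *m u^T) + H in
  dot u u = 1 -> op_bound H h -> 0 <= h -> 64 * h <= `|lam| -> lam != 0 ->
  M *m x = al *: x - be *: y -> M *m y = be *: x + al *: y ->
  0 < dot x x + dot y y -> `|lam| ^+ 2 <= 4 * (al ^+ 2 + be ^+ 2) -> be = 0.
Proof.
move=> M u1 Hh h0 hl l0 Mx My xy ab.
have nu : l2norm u = 1 by rewrite l2normE u1 sqrtr1.
have ml : 0 < `|lam| by rewrite normr_gt0.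
have ME z : M *m z = (lam * dot u z) *: u + H *m z.
  by rewrite mulmxDl -scalemxAl rank_one_mul scalerA.
have rot (p q : 'cV[R]_n) : dot (al *: p - be *: q) (al *: p - be *: q) +
     dot (be *: p + al *: q) (be *: p + al *: q) =
     (al ^+ 2 + be ^+ 2) * (dot p p + dot q q).
  rewrite !(dotDl, dotDr, dotNl, dotNr, dotZl, dotZr) (dotC q p); ring.
have Hd z : dot (H *m z) (H *m z) <= h ^+ 2 * dot z z.
  rewrite -!sqr_l2norm -exprMn; apply: lerXn2r => //; rewrite nnegrE ?l2norm_ge0 //.
  by rewrite mulr_ge0 ?l2norm_ge0.
have hh : 64 ^+ 2 * h ^+ 2 <= `|lam| ^+ 2.
  by rewrite -exprMn; apply: lerXn2r => //; rewrite nnegrE ?mulr_ge0.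
have l2 : 0 < `|lam| ^+ 2 by rewrite exprn_gt0.
set c1 := dot u x in ME *; set c2 := dot u y.
have [N0|N0] := eqVneq (c1 ^+ 2 + c2 ^+ 2) 0.
  move/eqP: N0; rewrite paddr_eq0 ?sqr_ge0 // !sqrf_eq0 => /andP[/eqP c10 /eqP c20].
  have := rot x y; rewrite -Mx -My !ME -/c1 -/c2 c10 c20 !mulr0 !scale0r !add0r => e.
  by case: (two_dim_scalar0 (esym e) (Hd x) (Hd y) xy hh ab l2).
(* [p + i q] is [x + i y] divided by [c1 + i c2], hence still an eigenvector. *)
pose N := c1 ^+ 2 + c2 ^+ 2.
pose p := N^-1 *: (c1 *: x + c2 *: y); pose q := N^-1 *: (c1 *: y - c2 *: x).
have up : dot u p = 1.
  rewrite /p dotZr dotDr !dotZr -/c1 -/c2 -!expr2 mulVf //.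
have uq : dot u q = 0.
  by rewrite /q dotZr dotDr dotNr !dotZr -/c1 -/c2; ring.
have Mp : lam *: u + H *m p = al *: p - be *: q.
  transitivity (M *m p); first by rewrite ME up mulr1.
  rewrite /p /q -scalemxAr mulmxDr -!scalemxAr Mx My.
  by apply/colP => i; rewrite !mxE; ring.
have Mq : H *m q = be *: p + al *: q.
  transitivity (M *m q); first by rewrite ME uq mulr0 scale0r add0r.
  rewrite /p /q -scalemxAr mulmxBr -!scalemxAr Mx My.
  by apply/colP => i; rewrite !mxE; ring.
move: p q up uq Mp Mq => p q up uq Mp Mq.
have beE : be = dot u (H *m q) by rewrite Mq dotDr !dotZr up uq; ring.
have be_le : `|be| <= h * l2norm q.
  by rewrite beE; apply: le_trans (dot_le _ _) _; rewrite nu mul1r.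
have al_le : `|al| * l2norm q <= h * l2norm q + `|be| * l2norm p.
  rewrite -!l2normZ (_ : al *: q = H *m q + - (be *: p)); last first.
    by rewrite Mq addrC addKr.
  by apply: le_trans (l2normD _ _) _; rewrite l2normN lerD2r.
(* Applying [M] multiplies the total squared norm by [al^2 + be^2 >= lam^2 / 4], while the result is
   at most about [2 lam^2]. *)
have pq : dot p p + dot q q <= 9.
  have := rot p q; rewrite -Mp -Mq.
  have hp : dot (lam *: u + H *m p) (lam *: u + H *m p) <=
      2 * `|lam| ^+ 2 + 2 * (h ^+ 2 * dot p p).
    have := dot_ge0 (lam *: u - H *m p); have := Hd p.
    rewrite real_normK ?num_real // !(dotDl, dotDr, dotNl, dotNr, dotZl, dotZr) u1.
    rewrite (dotC (H *m p) u).
    move: (dot u (H *m p)) (dot (H *m p) (H *m p)) (h ^+ 2 * _) => z1 z2 z3; clear; lra.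
  move=> e; apply: (two_dim_scalar1 (esym e) hp (Hd q) _ _ hh ab l2).
  - exact: dot_ge0.
  - exact: dot_ge0.
  - exact: sqr_ge0.
have pq' : dot p p <= 9 by apply: le_trans pq; rewrite lerDl dot_ge0.
have pq'' : dot q q <= 9 by apply: le_trans pq; rewrite lerDr dot_ge0.
have np : l2norm p <= 3.
  rewrite -(@ler_pXn2r _ 2) ?nnegrE ?l2norm_ge0 // sqr_l2norm.
  by apply: le_trans pq' _; lra.
have nq : l2norm q <= 3.
  rewrite -(@ler_pXn2r _ 2) ?nnegrE ?l2norm_ge0 // sqr_l2norm.
  by apply: le_trans pq'' _; lra.
have [q0|q0] := eqVneq (l2norm q) 0.
  by apply/eqP; rewrite -normr_le0; move: be_le; rewrite q0 mulr0.
have qp : 0 < l2norm q by rewrite lt_neqAle eq_sym q0 l2norm_ge0.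
have [al4 be3] := two_dim_scalar2 qp (l2norm_ge0 p) np nq h0 be_le al_le (normr_ge0 be).
exfalso; move: ab.
rewrite -(real_normK (num_real al)) -(real_normK (num_real be)).
by apply: (two_dim_scalar3 _ _ hh l2); rewrite normr_ge0.
Qed.

Lemma sum_geometric_le (r : R) N : 0 <= r <= 2^-1 ->
  \sum_(s < N) r ^+ s.+1 <= 2 * r.
Proof.
move=> /andP[r0 r2]; suff: \sum_(s < N) r ^+ s.+1 <= 2 * r - 2 * r ^+ N.+1.
  have := exprn_ge0 N.+1 r0; lra.
elim: N => [|N IH]; first by rewrite big_ord0 expr1 subrr.
rewrite big_ord_recr /=; have := exprn_ge0 N.+1 r0; rewrite [r ^+ N.+2]exprS; nra.
Qed.

(** The expansion of [x] in powers of [L = H / al] is stopped at [N]: the series costs [4 b r], the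
    factor [kap] being at most 2 and the geometric sum at most [2 r], and the remainder costs
    [b r]. *)
Lemma eigenvector_linear_form (lam h al b : R) u H x a N :
  let M := lam *: (u *m u^T) + H in
  dot u u = 1 -> dot x x = 1 -> dot a a = 1 -> op_bound H h -> 0 <= h ->
  64 * h <= `|lam| -> lam != 0 -> `|lam| <= 2 * `|al| ->
  M *m x = al *: x ->
  (forall s, (s < N)%N -> `|dot a (H ^+ s.+1 *m u)| <= b * h ^+ s.+1) ->
  2 ^- N <= b ->
  Num.min `|dot a (x - u)| `|dot a (x + u)| <=
    10 * (`|dot a u| + b) * (h / `|lam|).
Proof.
move=> M u1 x1 a1 Hh h0 hl l0 la Mx aH bN.
have nx : l2norm x = 1 by rewrite l2normE x1 sqrtr1.
have nu : l2norm u = 1 by rewrite l2normE u1 sqrtr1.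
have na : l2norm a = 1 by rewrite l2normE a1 sqrtr1.
have ml : 0 < `|lam| by rewrite normr_gt0.
have al0 : 0 < `|al| by lra.
have aln0 : al != 0 by rewrite -normr_gt0.
pose L := al^-1 *: H; pose kap := al^-1 * (lam * dot u x).
pose r := h / `|al|.
have r0 : 0 <= r by rewrite divr_ge0.
have r32 : r <= 32^-1 by rewrite /r ler_pdivrMr //; lra.
have rl : r <= 2 * (h / `|lam|).
  rewrite /r ler_pdivrMr // mulrAC -mulrA mulrC -mulrA.
  have : 1 <= 2 * (`|lam|^-1 * `|al|).
    by rewrite mulrCA ler_pdivlMl // mulr1.
  move=> h1; have := ler_wpM2l h0 h1; nra.
have b0 : 0 <= b by apply: le_trans bN; rewrite invr_ge0 exprn_ge0.
have LX s z : L ^+ s *m z = (al^-1) ^+ s *: (H ^+ s *m z).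
  elim: s z => [|s IH] z; first by rewrite !expr0 scale1r.
  rewrite !exprSr -!mulmxE -!mulmxA IH /L -scalemxAl -scalemxAr.
  by rewrite scalerA.
have Lr : op_bound L r.
  move=> z; rewrite /L -scalemxAl l2normZ normfV /r mulrAC [leRHS]mulrC.
  by rewrite ler_wpM2l ?invr_ge0.
have xE : x = kap *: u + L *m x.
  apply: (scalerI aln0); rewrite -Mx mulmxDl -scalemxAl rank_one_mul /L -scalemxAl.
  by rewrite scalerDr !scalerA mulrA divff // mul1r scale1r.
have xS S : x = \sum_(s < S) kap *: (L ^+ s *m u) + L ^+ S *m x.
  elim: S => [|S IH]; first by rewrite big_ord0 add0r mul1mx.
  rewrite big_ord_recr /= -addrA {1}IH; congr (_ + _).
  by rewrite {1}xE mulmxDr -scalemxAr mulmxA mulmxE -exprSr.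
(* [kap *: u] is [x - L x], with [x] of norm one and [L x] of norm at most [r]. *)
have kap1 : `| `|kap| - 1 | <= r.
  have -> : `|kap| = l2norm (kap *: u) by rewrite l2normZ nu mulr1.
  rewrite -{1}nx distrC; apply: le_trans (l2normB _ _) _.
  by rewrite {1}xE addrAC subrr add0r; have := Lr x; rewrite nx mulr1.
have kap2 : `|kap| <= 2 by move: kap1; rewrite ler_norml => /andP[]; lra.
have main : `|dot a x - kap * dot a u| <= 5 * b * r.
  rewrite {1}(xS N.+1) dotDr big_ord_recl /= expr0 mul1mx dotDr dotZr.
  rewrite addrC !addrA addNr add0r; apply: le_trans (ler_normD _ _) _.
  have e1 : `|dot a (\sum_(s < N) kap *: (L ^+ (lift ord0 s) *m u))| <= 4 * b * r.
    rewrite /dot mulmx_sumr summxE; apply: le_trans (ler_norm_sum _ _ _) _.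
    apply: (@le_trans _ _ (\sum_(s < N) 2 * b * r ^+ s.+1)).
      apply: ler_sum => s _; rewrite -/(dot a _) dotZr normrM -mulrA.
      apply: ler_pM => //; rewrite LX dotZr normrM normrX normfV.
      rewrite /r exprMn exprVn mulrC mulrA ler_wpM2r //.
      exact: aH.
    rewrite -mulr_sumr; apply: (geometric_scalar b0 (lexx _)).
    by apply: sum_geometric_le; rewrite r0 /=; apply: le_trans r32 _; lra.
  have e2 : `|dot a (L ^+ N.+1 *m x)| <= b * r.
    apply: le_trans (dot_le _ _) _; rewrite na mul1r.
    apply: le_trans (op_boundX _ _ r0 Lr) _; rewrite nx mulr1 exprSr ler_wpM2r //.
    (* One factor [r] is kept; the other [N] are at most 1/2 each. *)
    apply: le_trans bN; rewrite -exprVn; apply: lerXn2r => //; rewrite ?nnegrE ?invr_ge0 //.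
    lra.
  lra.
have side : `|dot a x - Num.sg kap * dot a u| <= 5 * b * r + r * `|dot a u|.
  have -> : dot a x - Num.sg kap * dot a u =
     (dot a x - kap * dot a u) + (kap - Num.sg kap) * dot a u by ring.
  apply: le_trans (ler_normD _ _) _; apply: lerD => //.
  rewrite normrM ler_wpM2r //; apply: (le_trans _ kap1).
  have k0 : kap != 0 by rewrite -normr_gt0; move: kap1; rewrite ler_norml => /andP[]; lra.
  rewrite {1}[kap]numEsg -{2}[Num.sg kap]mulr1 -mulrBr normrM normr_sg k0 mul1r //.
apply: (@le_trans _ _ (5 * b * r + r * `|dot a u|)); last first.
  apply: final_scalar rl => //; exact: divr_ge0.
(* The sign of [kap] decides which of [u] and [- u] is close to [x]. *)
rewrite ge_min; apply/orP; have [kp|kn|k0] := ltrgt0P kap.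
- left; by move: side; rewrite gtr0_sg // mul1r dotDr dotNr.
- right; by move: side; rewrite ltr0_sg // mulN1r opprK dotDr.
- right; move: kap1; rewrite k0 normr0 sub0r normrN1 => h1; exfalso; move: r32.
  by rewrite leNgt (lt_le_trans _ h1) // invf_lt1 // ltr1n.
Qed.

End Spectral.

(** * Complex eigenvectors *)

Section Complexification.
Variables (R : realType) (n : nat).
Local Notation normc := ComplexField.Normc.normc.
Implicit Types (x y : 'cV[R]_n) (M H : 'M[R]_n) (u : 'cV[R[i]]_n).

Lemma normc_real (r : R) : normc (real_complex R r) = `|r|.
Proof. by rewrite /= expr0n addr0 sqrtr_sqr. Qed.

Lemma Re_mulmx M u i :
  complex.Re ((complexify M *m u) i 0) = (M *m map_mx (@complex.Re R) u) i 0.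
Proof.
rewrite !mxE (big_morph (@complex.Re R) (id1 := 0) (op1 := +%R)) //; last by case=> [??][??].
by apply: eq_bigr => j _; rewrite !mxE; case: (u j 0) => p q /=; rewrite mul0r subr0.
Qed.

Lemma Im_mulmx M u i :
  complex.Im ((complexify M *m u) i 0) = (M *m map_mx (@complex.Im R) u) i 0.
Proof.
rewrite !mxE (big_morph (@complex.Im R) (id1 := 0) (op1 := +%R)) //; last by case=> [??][??].
by apply: eq_bigr => j _; rewrite !mxE; case: (u j 0) => p q /=; rewrite mul0r addr0.
Qed.

(** [eigenvalue] refers to row vectors, so the column eigenvector is transposed; [M] and [M^T] share
    their characteristic polynomial, whose real root remains a root over the complex numbers. *)
Lemma eigenvalue_complexify M (t : R) (v : 'cV[R]_n) :
  v != 0 -> M *m v = t *: v -> eigenvalue (complexify M) (real_complex R t).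
Proof.
move=> v0 Mv; rewrite eigenvalue_root_char -map_char_poly; apply: rmorph_root.
have -> : char_poly M = char_poly M^T.
  rewrite /char_poly -det_tr; congr (\det _).
  by apply/matrixP => i j; rewrite !mxE eq_sym.
rewrite -eigenvalue_root_char; apply/eigenvalueP; exists v^T.
  by rewrite -trmx_mul Mv linearZ.
by apply: contra v0 => /eqP h; rewrite -[v]trmxK h trmx0.
Qed.

Lemma lin_form_complexify (a y : 'cV[R]_n) : normc (lin_form a (complexify y)) = `|dot a y|.
Proof. by rewrite /lin_form /complexify map_trmx -map_mxM mxE normc_real. Qed.

(** The real eigenvalue [lam * t], [t >= 1/2], forces the leading one to have modulus at least half
    of [|lam|]; [leading_real] then makes it real, and with it the eigenvector. *)
Lemma leading_eigenvector_real (lam h : R) (us : 'cV[R]_n) H u :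
  let M := lam *: (us *m us^T) + H in
  dot us us = 1 -> op_bound H h -> 0 <= h -> 64 * h <= `|lam| -> lam != 0 ->
  leading_eigenvector M u ->
  exists (al : R) x, [/\ u = complexify x, M *m x = al *: x, dot x x = 1 &
    `|lam| <= 2 * `|al|].
Proof.
move=> M us1 Hh h0 hl l0 [[al be] [_ lead Mu u1 real]].
have ml : 0 < `|lam| by rewrite normr_gt0.
pose x := map_mx (@complex.Re R) u; pose y := map_mx (@complex.Im R) u.
have Mx : M *m x = al *: x - be *: y.
  apply/colP => i; rewrite -Re_mulmx Mu !mxE.
  by case: (u i 0) => p q /=.
have My : M *m y = be *: x + al *: y.
  apply/colP => i; rewrite -Im_mulmx Mu !mxE.
  by case: (u i 0) => p q /=; rewrite addrC.
have xy1 : dot x x + dot y y = 1.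
  rewrite !dotE -big_split /= -[RHS](expr1n _ 2) -u1 /l2normC sqr_sqrtr; last first.
    by apply: sumr_ge0 => i _; exact: sqr_ge0.
  apply: eq_bigr => i _; rewrite !mxE; case: (u i 0) => p q /=.
  by rewrite sqr_sqrtr ?addr_ge0 ?sqr_ge0 // !expr2.
have ab : `|lam| ^+ 2 <= 4 * (al ^+ 2 + be ^+ 2).
  have Gh : op_bound (lam^-1 *: H) (h / `|lam|).
    move=> z; rewrite -scalemxAl l2normZ normfV mulrAC [leRHS]mulrC.
    by rewrite ler_wpM2l ?invr_ge0.
  have [|t [v [t2 v0 tv]]] := rank_one_eigenvalue us1 Gh.
    by rewrite divr_ge0 //= ler_pdivrMr // ler_pdivlMl.
  have Mv : M *m v = (lam * t) *: v.
    rewrite -scalerA -tv scalemxAl; congr (_ *m _).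
    by rewrite scalerDr scalerA divff // scale1r.
  have := lead _ (eigenvalue_complexify v0 Mv); rewrite normc_real /= => le1.
  have : `|lam| <= 2 * Num.sqrt (al ^+ 2 + be ^+ 2).
    apply: (@le_trans _ _ (2 * `|lam * t|)); last by rewrite ler_pM2l.
    rewrite normrM mulrCA ler_pMr // (ger0_norm (le_trans _ t2)) ?invr_ge0 //; lra.
  move=> le2.
  rewrite -[X in _ <= 4 * X]sqr_sqrtr ?addr_ge0 ?sqr_ge0 //.
  rewrite (_ : 4 * _ = (2 * Num.sqrt (al ^+ 2 + be ^+ 2)) ^+ 2); last first.
    by rewrite exprMn; congr (_ * _); ring.
  by apply: lerXn2r; rewrite ?nnegrE ?mulr_ge0 ?sqrtr_ge0.
have be0 : be = 0.
  by apply: (leading_real us1 Hh h0 hl l0 Mx My) => //; rewrite xy1.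
have y0 : y = 0 by apply/colP => i; rewrite !mxE; exact: real.
exists al, x; split.
- apply/colP => i; rewrite !mxE.
  by have := real be0 i; case: (u i 0) => p q /= ->.
- by rewrite Mx be0 scale0r subr0.
- by rewrite -xy1 y0 -(scale0r 0) dotZr mul0r addr0.
- rewrite -(@ler_pXn2r _ 2) ?nnegrE ?mulr_ge0 // exprMn real_normK ?num_real //.
  rewrite [`|al| ^+ 2]real_normK ?num_real //.
  move: ab; rewrite be0 expr0n addr0 real_normK ?num_real // => /le_trans; apply; lra.
Qed.

End Complexification.

(** * Truncation *)

Section Truncation.
Context d (T : measurableType d) (R : realType) (P : probability T R).
Local Notation Ex := (Ex P).
Implicit Types (X : {RV P >-> R}) (B : R).

Definition truncate B (x : R) : R := x * \1_[set y | `|y| <= B] x.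

Lemma measurable_norm_le B : measurable [set y : R | `|y| <= B].
Proof.
rewrite (_ : [set _ | _] = `[- B, B]%classic); first exact: measurable_itv.
by apply/seteqP; split => y; rewrite /= in_itv /= ler_norml.
Qed.

Lemma truncate_id B x : `|x| <= B -> truncate B x = x.
Proof. by move=> xB; rewrite /truncate indicE mem_set // mulr1. Qed.

Lemma truncate_out B x : B < `|x| -> truncate B x = 0.
Proof.
by move=> xB; rewrite /truncate indicE memNset ?mulr0 //= => /(lt_le_trans xB); rewrite ltxx.
Qed.

Lemma truncateN B x : truncate B (- x) = - truncate B x.
Proof.
case: (lerP `|x| B) => h; first by rewrite !truncate_id ?normrN.
by rewrite !truncate_out ?normrN ?oppr0.
Qed.

Lemma norm_truncate_le B x : 0 <= B -> `|truncate B x| <= B.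
Proof.
move=> B0; case: (lerP `|x| B) => h; first by rewrite truncate_id.
by rewrite truncate_out ?normr0.
Qed.

Lemma bmeas_truncate B : 0 <= B -> bmeas (truncate B).
Proof.
move=> B0; split; last by exists B => x; exact: norm_truncate_le.
apply: measurable_funM; first exact: measurable_id.
exact: measurable_indic (measurable_norm_le B).
Qed.

Lemma measurable_norm_gt X B : measurable [set w | B < `|X w|].
Proof.
rewrite (_ : [set _ | _] = X @^-1` (~` [set y | `|y| <= B])).
  rewrite -[X in measurable X]setTI; apply: measurable_funPT => //.
  by apply: measurableC; exact: measurable_norm_le.
by apply/seteqP; split => w /=; [move=> h; apply/negP|move/negP]; rewrite -ltNge.
Qed.

Lemma ae_bounded_tail X B : {ae P, forall w, `|X w| <= B} ->
  P [set w | B < `|X w|] = 0%E.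
Proof.
move=> h; apply/negligibleP; first exact: measurable_norm_gt.
by apply: negligibleS h => w /= hw /(lt_le_trans hw); rewrite ltxx.
Qed.

Lemma Ex_truncate_ae X B : 0 <= B -> {ae P, forall w, `|X w| <= B} ->
  'E_P[X]%E = 0%E -> Ex (fun w => truncate B (X w)) = 0.
Proof.
move=> B0 aeB; rewrite expectation_def => X0.
rewrite /Ex /Rintegral (@ae_eq_integral _ _ _ P setT (fun w => (X w)%:E)) ?X0 //.
- by apply/measurable_EFinP; have [] := bmeas_comp X (bmeas_truncate B0).
- exact/measurable_EFinP.
- by apply: filterS aeB => w wB _; rewrite truncate_id.
Qed.

Lemma Ex_symmetric X (phi : R -> R) : symmetric_distribution X -> bmeas phi ->
  Ex (fun w => phi (X w)) = Ex (fun w => phi (- X w)).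
Proof.
move=> sX bphi.
have mX : measurable_fun setT (fun w => - X w) by exact: measurable_funN.
pose Y : {RV P >-> R} := mfun_Sub (mem_set mX).
have E (Z : {RV P >-> R}) : Ex (fun w => phi (Z w)) = fine (\int[distribution P Z]_y (phi y)%:E).
  rewrite /Ex /Rintegral integral_distribution //.
    by apply/measurable_EFinP; exact: bphi.1.
  exact: bmeas_integrable (bmeas_comp Z bphi).
rewrite (E X) -[RHS]/(Ex (fun w => phi (Y w))) (E Y); congr fine.
by apply: eq_measure_integral => A mA _; exact: sX.
Qed.

(** Truncation is odd, so symmetry makes the expectation equal to its opposite. *)
Lemma Ex_truncate_symmetric X B : 0 <= B -> symmetric_distribution X ->
  Ex (fun w => truncate B (X w)) = 0.
Proof.
move=> B0 sX; have bt := bmeas_truncate B0.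
have := Ex_symmetric sX bt; under [X in _ = Ex X]funext do rewrite truncateN -mulN1r.
rewrite ExZ; [lra|exact: bmeas_comp].
Qed.

(** For a centred variable the variance is the second moment, and truncation lowers the square
    pointwise. *)
Lemma Ex_truncate_sqr X B (s : R) : 0 <= B -> 'E_P[X]%E = 0%E ->
  ('V_P[X] <= s%:E)%E -> Ex (fun w => truncate B (X w) ^+ 2) <= s.
Proof.
move=> B0 X0 Vs.
have b2 : bmeas (fun w => truncate B (X w) ^+ 2).
  by apply: bmeasX; apply: bmeas_comp; exact: bmeas_truncate.
rewrite -lee_fin /Ex /Rintegral fineK; last exact: integrable_fin_num (bmeas_integrable P b2).
apply: le_trans Vs; rewrite /variance covariance.unlock X0 expectation.unlock /=.
apply: ge0_le_integral => //.
- by move=> w _; rewrite lee_fin sqr_ge0.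
- by apply/measurable_EFinP; exact: b2.1.
- apply/measurable_EFinP.
  by apply: measurable_funM; apply: measurable_funB => //; exact: measurable_cst.
move=> w _; rewrite lee_fin [leRHS](_ : _ = (X w - 0) * (X w - 0)) // subr0 -expr2.
case: (lerP `|X w| B) => h; first by rewrite truncate_id.
by rewrite truncate_out // expr0n sqr_ge0.
Qed.

Lemma union_bound (I : finType) (A : I -> set T) : (forall i, measurable (A i)) ->
  measurable (\bigcup_i A i) /\
  fine (P (\bigcup_i A i)) <= \sum_i fine (P (A i)).
Proof.
move=> mA; have mU : measurable (\bigcup_i A i).
  by apply: fin_bigcup_measurable => //; exact: finite_finset.
split => //.
rewrite -Ex_indic //; under eq_bigr do rewrite -Ex_indic //.
rewrite -Ex_sum; last by move=> i; exact: bmeas_indic.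
apply: le_Ex; [exact: bmeas_indic|by apply: bmeas_sum => i; exact: bmeas_indic|].
move=> w; rewrite indicE; case: (boolP (w \in _)) => [/set_mem[i _ Aiw]|_].
  rewrite (bigD1 i) //= indicE mem_set // lerDl.
  by apply: sumr_ge0 => j _; rewrite indicE ler0n.
by apply: sumr_ge0 => j _; rewrite indicE ler0n.
Qed.

Lemma fine_probability_setU (A B : set T) : measurable A -> measurable B ->
  fine (P (A `|` B)) <= fine (P A) + fine (P B).
Proof.
move=> mA mB; rewrite -fineD ?fin_num_measure // fine_le ?fin_num_measure //.
- exact: measurableU.
- by rewrite fin_numD !fin_num_measure.
- exact: measureU2.
Qed.

Lemma noise_centred_bounded (cb sigma B : R) n (H : 'I_n -> 'I_n -> {RV P >-> R}) :
  0 < B -> noise_assumption cb sigma B H ->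
  centred_bounded P (sigma ^+ 2) B
    (fun (ij : 'I_n * 'I_n) w => truncate B (H ij.1 ij.2 w)).
Proof.
move=> /ltW B0 [indH EH VH tailH]; have bt := bmeas_truncate B0; split.
- by move=> e; exact: (bmeas_comp (H e.1 e.2) bt).
- by move=> e w; exact: norm_truncate_le.
- move=> e; case: (tailH e.1 e.2) => [ae|[sym _]].
    exact: Ex_truncate_ae.
  exact: Ex_truncate_symmetric.
- by move=> e; exact: Ex_truncate_sqr.
- move=> m; apply: (Ex_prod_indep (f := fun e x => truncate B x ^+ m e) indH).
  by move=> e; exact: bmeasX.
Qed.

Lemma noise_tail (cb sigma B : R) n (H : 'I_n -> 'I_n -> {RV P >-> R}) :
  0 < cb -> noise_assumption cb sigma B H ->
  forall i j, fine (P [set w | B < `|H i j w|]) <= cb * n%:R ^- 12.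
Proof.
move=> cb0 [_ _ _ tailH] i j; case: (tailH i j) => [/ae_bounded_tail ->|[_ h]] /=.
  by apply: mulr_ge0; [exact: ltW|rewrite invr_ge0 exprn_ge0].
rewrite -lee_fin fineK // fin_num_measure //; exact: measurable_norm_gt.
Qed.

End Truncation.

(** * The good event *)

(** The logarithm rounded up satisfies [(N - 1) ln 2 <= ln n]; with [1/2 <= ln 2 <= ln n] this gives
    the factor 4. *)
Lemma up_log2_le (R : realType) n : (1 < n)%N ->
  [/\ (n <= 2 ^ up_log 2 n)%N, (0 < up_log 2 n <= n)%N &
      (up_log 2 n)%:R <= 4 * ln n%:R :> R].
Proof.
move=> n1; have := up_log_bounds (isT : (1 < 2)%N) n1; set N := up_log 2 n => /= /andP[Nl Nu].
have N0 : (0 < N)%N by case: N Nu {Nl} => //; rewrite expn0 leqNgt n1.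
split => //.
  by rewrite N0 -(prednK N0); apply: leq_trans Nl; rewrite ltnS ltnW // ltn_expl.
have n0 : 0 < n%:R :> R by rewrite ltr0n ltnW.
(* This is [ln (1 + x) <= x] at [x = -1/2]. *)
have ln2 : 2^-1 <= ln 2 :> R.
  have := @le_ln1Dx R (- 2^-1) _; rewrite (_ : 1 + - 2^-1 = 2^-1); last by lra.
  by rewrite lnV ?posrE //; lra.
have l2n : ln 2 <= ln n%:R :> R by rewrite ler_ln ?posrE // ler_nat.
have l1 : N.-1%:R * ln 2 <= ln n%:R :> R.
  rewrite mulr_natl -lnXn // ler_ln ?posrE ?exprn_gt0 // -natrX ler_nat.
  exact: ltnW.
have l2 : N%:R * ln 2 <= 2 * ln n%:R :> R.
  rewrite -{1}(prednK N0) -natr1 mulrDl mul1r; lra.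
have : N%:R * 2^-1 <= N%:R * ln 2 :> R by rewrite ler_wpM2l.
lra.
Qed.

(** The even power to which a bilinear form of degree [s + 1] is raised: total length at least
    [12 N], for a tail of [n^-12], and of order [ln n]. *)
Lemma copies_bounds N s : (s < N)%N ->
  (12 * N <= ((6 * N) %/ s.+1).+1.*2 * s.+1 <= 32 * N)%N.
Proof.
move=> sN; have := divn_eq (6 * N) s.+1; have := ltn_pmod (6 * N) (ltn0Sn s).
move: (_ %/ _)%N (_ %% _)%N => q r; nia.
Qed.

(** The exponent must be a power of two for [op_bound_trace]; length at least [16 N] absorbs the
    factor [n] of the trace. *)
Lemma trace_power_bounds N : (0 < N)%N ->
  (16 * N <= (2 ^ up_log 2 (4 * N)).*2.*2 <= 32 * N)%N.
Proof.
move=> N0; have N1 : (1 < 4 * N)%N by lia.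
have /andP[l1 l2] := up_log_bounds (isT : (1 < 2)%N) N1.
have : (0 < up_log 2 (4 * N))%N by rewrite up_log_gt0 N1.
case: (up_log 2 (4 * N)) l1 l2 => // e; rewrite expnS /=; lia.
Qed.

Section GoodEvent.
Context d (T : measurableType d) (R : realType) (P : probability T R).
Variables (cb sigma B : R) (n : nat) (H : 'I_n -> 'I_n -> {RV P >-> R}).
Hypothesis cb_gt0 : 0 < cb.
Hypothesis n_gt1 : (1 < n)%N.
Hypothesis B_gt0 : 0 < B.
Hypothesis sigma_ge0 : 0 <= sigma.
Hypothesis noiseH : noise_assumption cb sigma B H.

Let N := up_log 2 n.
Let Delta := Num.max (sigma * Num.sqrt (n%:R * ln n%:R)) (B * ln n%:R).

(* All moments used have length [m <= 32 N <= 128 ln n], hence the scale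
   [128 * Delta] for [D] in [moment_bound]. *)
Lemma noise_scale m : (m <= 32 * N)%N ->
  n%:R * m%:R * sigma ^+ 2 <= (128 * Delta) ^+ 2 /\ m%:R * B <= 128 * Delta.
Proof.
move=> mN; have [_ _ N4] := up_log2_le R n_gt1.
have n0 : 0 < n%:R :> R by rewrite ltr0n ltnW.
have l0 : 0 <= ln n%:R :> R by rewrite ln_ge0 // ler1n ltnW.
have mL : m%:R <= 128 * ln n%:R :> R.
  have : m%:R <= (32 * N)%:R :> R by rewrite ler_nat.
  rewrite natrM -/N in N4 *; lra.
have D1 : sigma * Num.sqrt (n%:R * ln n%:R) <= Delta by rewrite le_max lexx.
have D2 : B * ln n%:R <= Delta by rewrite le_max lexx orbT.
split.
  have e : (sigma * Num.sqrt (n%:R * ln n%:R)) ^+ 2 <= Delta ^+ 2.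
    apply: lerXn2r => //; rewrite nnegrE ?mulr_ge0 ?sqrtr_ge0 //.
    by apply: le_trans D1; rewrite mulr_ge0 ?sqrtr_ge0.
  rewrite exprMn sqr_sqrtr in e; last by rewrite mulr_ge0 // ltW.
  have : n%:R * sigma ^+ 2 * m%:R <= n%:R * sigma ^+ 2 * (128 * ln n%:R).
    by rewrite ler_wpM2l // mulr_ge0 ?sqr_ge0 // ltW.
  have := sqr_ge0 Delta; rewrite exprMn; lra.
have : m%:R * B <= 128 * ln n%:R * B by rewrite ler_wpM2r // ltW.
lra.
Qed.

Lemma noise_scale_gt0 : 0 < Delta.
Proof.
rewrite lt_max; apply/orP; right; rewrite mulr_gt0 // ln_gt0 //.
by rewrite ltr1n.
Qed.

Variables (a u : 'cV[R]_n) (b : R).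
Hypothesis a_unit : dot a a = 1.
Hypothesis u_le : forall i, `|u i 0| <= b.
Hypothesis b_gt0 : 0 < b.

(** Three kinds of bad event are removed: a large bilinear form (at most [n] of them), a large
    trace, and an entry above [B] ([n^2] of them). Each has probability of order [n^-12]. *)
Lemma good_event : exists E : set T, [/\ measurable E,
  ((1 - (cb + 2) * n%:R ^- 10)%:E <= P E)%E &
  forall w, E w ->
    op_bound (noise_matrix H w) (4 * (128 * Delta)) /\
    (forall s, (s < N)%N ->
       `|dot a (noise_matrix H w ^+ s.+1 *m u)| <= b * (4 * (128 * Delta)) ^+ s.+1)].
Proof.
have [nN /andP[N0 Nn] N4] := up_log2_le R n_gt1; rewrite -/N in nN N0 Nn N4.
have n0 : (0 < n)%N by exact: ltnW.
have nR : 0 < n%:R :> R by rewrite ltr0n.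
have n1R : 1 <= n%:R :> R by rewrite ler1n.
have D0 := noise_scale_gt0.
pose X (ij : 'I_n * 'I_n) w := truncate B (H ij.1 ij.2 w).
have cX : centred_bounded P (sigma ^+ 2) B X by exact: noise_centred_bounded noiseH.
have D128 : 0 < 128 * Delta by rewrite mulr_gt0.
have pow2 m k : (k * N <= m)%N -> 2 ^- m <= n%:R ^- k :> R.
  move=> km; rewrite lef_pV2 ?posrE ?exprn_gt0 // -!natrX ler_nat.
  apply: leq_trans (leq_pexp2l (isT : (0 < 2)%N) km).
  by case: k km => [|k] _; rewrite ?expn_gt0 // mulnC expnM leq_exp2r.
pose k (s : 'I_N) := ((6 * N) %/ s.+1).+1.*2.
pose A1 (s : 'I_N) := [set w | b * (4 * (128 * Delta)) ^+ s.+1 <=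
   `|(a^T *m rmatrix X w ^+ s.+1 *m u) 0 0|].
have A1P (s : 'I_N) : measurable (A1 s) /\ fine (P (A1 s)) <= n%:R ^- 12.
  have /andP[k1 k2] := copies_bounds (ltn_ord s).
  have [h1 h2] := noise_scale k2.
  have a1 : \sum_i a i 0 ^+ 2 <= 1.
    by rewrite -a_unit dotE; apply: ler_sum => i _; rewrite expr2.
  have k0 : (0 < k s)%N by rewrite /k double_gt0.
  have ke : ~~ odd (k s) by rewrite /k odd_double.
  have [mA pA] := bilinear_tail cX n0 (sqr_ge0 _) (ltW B_gt0) a1 u_le b_gt0 D128 k0 ke h1 h2.
  by split => //; apply: le_trans pA (pow2 _ _ k1).
pose K := (2 ^ up_log 2 (4 * N))%N.
have /andP[K16 K32] := trace_power_bounds N0; rewrite -/K in K16 K32.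
have K0 : (0 < K)%N by rewrite expn_gt0.
pose A2 := [set w | (4 * (128 * Delta)) ^+ K.*2.*2 <=
    \tr (((rmatrix X w)^T *m rmatrix X w) ^+ K.*2)].
have A2P : measurable A2 /\ fine (P A2) <= n%:R ^- 12.
  have [h1 h2] := noise_scale K32.
  have [mA pA] := trace_tail cX n0 (sqr_ge0 _) (ltW B_gt0) D128 K0 h1 h2.
  split => //; apply: le_trans pA _.
  apply: (@le_trans _ _ (n%:R * n%:R ^- 16)).
    by rewrite ler_wpM2l // pow2.
  rewrite [in X in _ * X]exprS invfM mulrA divff ?gt_eqF // mul1r.
  by rewrite lef_pV2 ?posrE ?exprn_gt0 // ler_weXn2l.
pose A3 (ij : 'I_n * 'I_n) := [set w | B < `|H ij.1 ij.2 w|].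
have A3P ij : measurable (A3 ij) /\ fine (P (A3 ij)) <= cb * n%:R ^- 12.
  by split; [exact: measurable_norm_gt|exact: noise_tail noiseH _ _].
have [mU1 pU1] := union_bound P (fun s => (A1P s).1).
have [mU3 pU3] := union_bound P (fun ij => (A3P ij).1).
have [mA2 pA2] := A2P.
set U1 := \bigcup_i A1 i in mU1 pU1; set U3 := \bigcup_i A3 i in mU3 pU3.
have mBad : measurable (U1 `|` A2 `|` U3).
  by apply: measurableU => //; exact: measurableU.
exists (~` (U1 `|` A2 `|` U3)); split.
- exact: measurableC.
- rewrite probability_setC // -[P _]fineK ?fin_num_measure // -EFinB lee_fin lerD2l lerN2.
  apply: le_trans (fine_probability_setU P (measurableU _ _ mU1 mA2) mU3) _.
  apply: (@le_trans _ _ (n%:R ^- 10 + n%:R ^- 10 + cb * n%:R ^- 10)); last by lra.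
  have e12 : n%:R ^- 12 * n%:R ^+ 2 = n%:R ^- 10 :> R.
    by rewrite (exprD _ 10 2) invfM -mulrA mulVf ?mulr1 // expf_neq0 // gt_eqF.
  have e10 : n%:R ^- 12 <= n%:R ^- 10 :> R.
    by rewrite lef_pV2 ?posrE ?exprn_gt0 // ler_weXn2l.
  apply: lerD.
    apply: le_trans (fine_probability_setU P mU1 mA2) _; apply: lerD.
      apply: le_trans pU1 _; apply: le_trans (ler_sum _ (fun s _ => (A1P s).2)) _.
      rewrite sumr_const card_ord -[leLHS]mulr_natr -e12.
      rewrite ler_wpM2l ?invr_ge0 ?exprn_ge0 // -natrX ler_nat.
      by apply: leq_trans Nn _; rewrite leq_pmulr.
    exact: le_trans pA2 e10.
  apply: le_trans pU3 _; apply: le_trans (ler_sum _ (fun ij _ => (A3P ij).2)) _.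
  by rewrite sumr_const card_prod !card_ord -[leLHS]mulr_natr -e12 natrM expr2 !mulrA.
move=> w /= bad.
have HB i j : `|H i j w| <= B.
  by rewrite leNgt; apply/negP => h; apply: bad; right; exists (i, j).
(* Off the bad events truncation changes nothing, so the bounds pass to the original noise. *)
have XH : rmatrix X w = noise_matrix H w.
  by apply/matrixP => i j; rewrite !mxE /X /= truncate_id.
have h0 : 0 <= 4 * (128 * Delta) by apply: mulr_ge0; [exact: ler0n|exact: ltW].
split.
  apply: (@op_bound_trace _ _ _ _ (up_log 2 (4 * N)) h0).
  rewrite leNgt; apply/negP => h; apply: bad; left; right.
  by rewrite /A2 /= XH ltW.
move=> s sN; rewrite leNgt; apply/negP => h; apply: bad; left; left.
exists (Ordinal sN) => //; rewrite /A1 /= XH ltW //.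
by move: h; rewrite /dot mulmxA.
Qed.

End GoodEvent.

(** * The bound on linear forms of the leading eigenvector *)

Theorem corollary2 (R : realType) (cb : R) (hcb : 0 < cb) :
  exists c1 C C' : R, [/\ 0 < c1, 0 < C & 0 < C'] /\
  forall (n : nat) (lamstar mu : R) (ustar : 'cV[R]_n)
    (d : measure_display) (T : measurableType d) (P : probability T R)
    (sigma B : R) (H : 'I_n -> 'I_n -> {RV P >-> R})
    (u : T -> 'cV[R[i]]_n),
  lamstar != 0 ->
  l2norm ustar = 1 ->
  incoherence_parameter ustar mu ->
  0 <= sigma -> 0 < B ->
  noise_assumption cb sigma B H ->
  Num.max (sigma * Num.sqrt (n%:R * ln n%:R)) (B * ln n%:R)
    <= c1 * `|lamstar| ->
  (forall w : T,
     leading_eigenvector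
       (lamstar *: (ustar *m ustar^T) + noise_matrix H w) (u w)) ->
  forall a : 'cV[R]_n, l2norm a = 1 ->
  with_probability_at_least P (1 - C' * n%:R ^- 10)
    [set w : T |
      Num.min
        (ComplexField.Normc.normc (lin_form a (u w - complexify ustar)))
        (ComplexField.Normc.normc (lin_form a (u w + complexify ustar)))
      <= C * (`|(a^T *m ustar) 0 0| + Num.sqrt (mu / n%:R))
         * (Num.max (sigma * Num.sqrt (n%:R * ln n%:R)) (B * ln n%:R)
            / `|lamstar|)].
Proof.
(* The noise bound is [h = 4 * 128 * Delta]: [c1] ensures [64 * h <= |lam|], [C] is the 10 of
   [eigenvector_linear_form] times [4 * 128], and [C'] comes from [good_event]. *)
exists ((64 * (4 * 128))^-1), (10 * (4 * 128)), (cb + 2); split.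
  split; last by lra.
    by rewrite invr_gt0 !mulr_gt0 ?ltr0n.
  by rewrite !mulr_gt0 ?ltr0n.
move=> n lam mu us d T P sigma B H u lam0 us1 [[mu0 incoh] _] sigma0 B0 noiseH.
move=> small lead a a1.
have dus : dot us us = 1 by rewrite -sqr_l2norm us1 expr1n.
have da : dot a a = 1 by rewrite -sqr_l2norm a1 expr1n.
set b := Num.sqrt (mu / n%:R) in incoh *.
have usb i : `|us i 0| <= b.
  apply: le_trans incoh; rewrite mx_normrE.
  exact: (le_bigmax _ (fun ij => `|us ij.1 ij.2|) (i, 0)).
(* For [n = 1] the required probability [1 - (cb + 2)] is negative and the empty event suffices;
   [n = 0] contradicts the unit norm. *)
have [n1|n1] := leqP n 1.
  exists set0; split => //; rewrite measure0 lee_fin.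
  have : (0 < n)%N.
    rewrite lt0n; apply/eqP => n0; move: dus; rewrite dotE big1 => [/eqP|i].
      by rewrite eq_sym oner_eq0.
    by have := ltn_ord i; rewrite {2}n0.
  move=> n0; have -> : n = 1%N by apply/eqP; rewrite eqn_leq n1.
  rewrite expr1n invr1; lra.
have nR : 0 < n%:R :> R by rewrite ltr0n ltnW.
have b0 : 0 <= b by exact: sqrtr_ge0.
(* The unit norm forces [b >= n^(-1/2)], so that [b] is positive and dominates the remainder
   [2 ^- N <= 1 / n]. *)
have nb : 1 <= n%:R * b ^+ 2.
  rewrite -[leLHS]dus dotE.
  apply: (@le_trans _ _ (\sum_(i < n) b ^+ 2)).
    apply: ler_sum => i _; rewrite -expr2 -real_normK ?num_real //.
    by apply: lerXn2r; rewrite ?nnegrE.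
  by rewrite sumr_const card_ord -[leLHS]mulr_natl.
have bp : 0 < b.
  rewrite lt_neqAle b0 andbT; apply/eqP => e; move: nb.
  by rewrite -e expr0n /= mulr0 ler10.
have [nN _ _] := up_log2_le R n1.
have bN : 2 ^- up_log 2 n <= b.
  apply: (@le_trans _ _ n%:R^-1).
    by rewrite lef_pV2 ?posrE ?exprn_gt0 // -natrX ler_nat.
  rewrite -(@ler_pXn2r _ 2) ?nnegrE ?invr_ge0 ?ler0n //.
  apply: (@le_trans _ _ n%:R^-1).
    rewrite exprVn lef_pV2 ?posrE ?exprn_gt0 // -natrX ler_nat leq_pmulr //.
    exact: ltnW.
  by rewrite -[leLHS]mulr1 ler_pdivrMl.
have [E [mE pE good]] := good_event hcb n1 B0 sigma0 noiseH da usb bp.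
set Delta := Num.max _ _ in small good *.
have D0 : 0 < Delta by exact: noise_scale_gt0.
exists E; split => // w Ew /=; have [Hop Hlin] := good w Ew.
have h0 : 0 <= 4 * (128 * Delta).
  by apply: mulr_ge0; rewrite ?ler0n // mulr_ge0 ?ler0n // ltW.
have hl : 64 * (4 * (128 * Delta)) <= `|lam|.
  by move: small; rewrite ler_pdivlMl ?mulrA // !mulr_gt0 ?ltr0n.
have [al [x [-> Mx x1 la]]] := leading_eigenvector_real dus Hop h0 hl lam0 (lead w).
rewrite /complexify -map_mxB -map_mxD !lin_form_complexify.
have := eigenvector_linear_form dus x1 da Hop h0 hl lam0 la Mx Hlin bN.
move=> /le_trans; apply.
rewrite le_eqVlt; apply/orP; left; apply/eqP; rewrite -/(dot a us); ring.
Qed.
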